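(* Let $f(z)=z+\sum_{n=2}^\infty a_nz^n$ belong to $\mathcal{S}^*_B$. Then $|a_2^2-a_3|\le\dfrac12$, and this inequality is sharp.
   Context: Let $\mathbb{D}=\{z\in\mathbb{C}:|z|<1\}$ and let $\mathcal{A}$ be the class of analytic functions $f$ in $\mathbb{D}$ with $f(0)=0$, $f'(0)=1$, so $f(z)=z+\sum_{n\ge2}a_nz^n$. For analytic $g,h$ in $\mathbb{D}$, $g\prec h$ (subordination) means $g(z)=h(w(z))$ for some analytic $w:\mathbb{D}\to\mathbb{D}$ with $w(0)=0$. The class is $$\mathcal{S}^*_B=\left\{f\in\mathcal{A}:\frac{zf'(z)}{f(z)}\prec\frac{1}{1-\log(1+z)},\ z\in\mathbb{D}\right\},$$ with $\log$ the principal branch. ''Sharp'' means that equality holds for some function in $\mathcal{S}^*_B$. *)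

(* Defs.v *)
From Stdlib Require Export Reals.
From Coquelicot Require Export Coquelicot.
Open Scope R_scope.
Open Scope C_scope.

Definition in_disk (z : C) : Prop := (Cmod z < 1)%R.

(* The structures are given explicitly because differentiability here is over
   the field C, not over R. *)
Definition analytic_in_disk (f : C -> C) : Prop :=
  forall z : C, in_disk z ->
    @ex_derive C_AbsRing C_NormedModule f z.

(* Principal argument, with values in (-PI, PI] for z <> 0. *)
Definition Carg (z : C) : R :=
  if Rle_dec 0 (Im z) then acos (Re z / Cmod z) else (- acos (Re z / Cmod z))%R.

(* Principal logarithm; its value at 0 carries no meaning. *)
Definition Clog (z : C) : C := (ln (Cmod z), Carg z).

Definition class_A (f : C -> C) : Prop :=
  analytic_in_disk f /\ f 0 = 0 /\ C_derive f 0 = 1.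

Definition subordinate (g h : C -> C) : Prop :=
  analytic_in_disk g /\ analytic_in_disk h /\
  exists w : C -> C,
    analytic_in_disk w /\
    (forall z : C, in_disk z -> in_disk (w z)) /\
    w 0 = 0 /\
    (forall z : C, in_disk z -> g z = h (w z)).

(* z f'(z) / f(z), with the removable singularity at 0 filled in by its limit,
   which is 1 whenever f(0) = 0 and f'(0) = 1. *)
Definition log_deriv_quotient (f : C -> C) (z : C) : C :=
  if Ceq_dec z 0 then 1 else z * C_derive f z / f z.

Definition phi_B (z : C) : C := 1 / (1 - Clog (1 + z)).

(* Division is total, so the nonvanishing of f away from 0, without which the
   quotient would not be an analytic function in the disk, is stated. *)
Definition class_S_B (f : C -> C) : Prop :=
  class_A f /\
  (forall z : C, in_disk z -> z <> 0 -> f z <> 0) /\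
  subordinate (log_deriv_quotient f) phi_B.

Definition has_expansion (f : C -> C) (a : nat -> C) : Prop :=
  a 0%nat = 0 /\ a 1%nat = 1 /\
  forall z : C, in_disk z -> @is_pseries C_AbsRing C_NormedModule a z (f z).

(* Main.v *)
Require Import Defs.
From Stdlib Require Import Wf_nat Lra Lia Psatz.

(* If z f'/f = phi_B (w) with w = c1 z + c2 z^2 + ..., then a2 = c1 and
   2 a3 - a2^2 = c2 + c1^2 / 2, so a2^2 - a3 = c1^2 / 4 - c2 / 2.  Bessel's
   inequality |c1|^2 + |c2|^2 <= 1 gives |c2| <= sqrt (1 - |c1|^2) <= 1 - |c1|^2 / 2,
   hence the bound 1/2.

   The regularity of w comes without Cauchy's integral formula: f is a power series, so
   w' = (z f'/f)' (1 + w) / (z f'/f)^2 is continuous, and for a holomorphic H on the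
   punctured disk with continuous derivative the circle means of Re H do not depend
   on the radius (differentiate under the integral).  Applied to the second Taylor
   remainder of w times a kernel with a double pole at 0, this says that the remainder
   is orthogonal to c1 z + c2 z^2 on every circle.

   Equality holds for w = - z^2.  There f(z) = z E(z^2) with
   2 u E'(u) = E(u) (phi_B(-u) - 1), and bounded coefficients of phi_B(-u) force
   bounded coefficients of E. *)

(** * Complex derivatives *)

(** The kernel comes from the identity conj z = r^2 / z on |z| = r: there the conjugate of P = c1 z
    + c2 z^2 is the restriction of a function holomorphic off 0. Because w - P = o(z^2), the
    remainder times this kernel tends to 0 at the origin, so its constant circle mean is 0.
    Integrating |P|^2 + 2 Re ((w - P) conj P) + |w - P|^2 = |w|^2 <= 1 and dropping the third term
    leaves |c1|^2 r^2 + |c2|^2 r^4 <= 1; then r tends to 1.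

    The extremal w is forced by the bound: sqrt (1 - t) = 1 - t / 2 only for t = 0, so equality
    requires c1 = 0 and |c2| = 1. That E has no zero is seen by solving the equation with the
    opposite sign as well: the product of the two solutions has derivative 0 and equals 1. *)

Definition Cderiv (f : C -> C) (z l : C) : Prop :=
  @is_derive C_AbsRing C_NormedModule f z l.

(** Unfolds the filter definition once, so that hands-on estimates can work with [Cmod] alone. *)
Lemma Cderiv_eps f z l : Cderiv f z l <->
  forall eps : R, (0 < eps)%R -> exists del : R, (0 < del)%R /\
    forall y, (Cmod (y - z) < del)%R ->
      (Cmod (f y - f z - (y - z) * l) <= eps * Cmod (y - z))%R.
Proof.
split.
- intros [_ H] eps he.
  destruct (H z (fun P h => h) (mkposreal eps he)) as [d hd].
  exists d; split; [apply cond_pos|].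
  intros y hy. exact (hd y hy).
- intros H. split.
  + apply is_linear_scal_l.
  + intros x hx.
    assert (E : z = x) by exact (is_filter_lim_locally_unique (V:=AbsRing_NormedModule C_AbsRing) z x hx).
    subst x. intros [eps he].
    destruct (H eps he) as [d [hd Hd]].
    exists (mkposreal d hd). intros y hy. exact (Hd y hy).
Qed.

(* [C_NormedModule] and the normed module [C_AbsRing] puts on itself carry
   different uniform structures, so generic results about functions K -> K have
   to be transported. *)
Lemma Cderiv_AbsRing (f : C -> C) (z l : C) :
  Cderiv f z l <-> @is_derive C_AbsRing (AbsRing_NormedModule C_AbsRing) f z l.
Proof.
split; intros [_ H]; (split; [apply is_linear_scal_l | exact H]).
Qed.

Lemma Cderiv_mult f g z df dg : Cderiv f z df -> Cderiv g z dg ->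
  Cderiv (fun y => f y * g y) z (df * g z + f z * dg).
Proof.
rewrite !Cderiv_AbsRing; intros hf hg.
exact (is_derive_mult (K:=C_AbsRing) f g z df dg hf hg Cmult_comm).
Qed.

Lemma Cderiv_comp f g z df dg : Cderiv f (g z) df -> Cderiv g z dg ->
  Cderiv (fun y => f (g y)) z (dg * df).
Proof.
rewrite !Cderiv_AbsRing; intros hf hg.
exact (is_derive_comp (K:=C_AbsRing) (V:=AbsRing_NormedModule C_AbsRing) f g z df dg hf hg).
Qed.

Lemma Cderiv_plus f g z df dg : Cderiv f z df -> Cderiv g z dg ->
  Cderiv (fun y => f y + g y) z (df + dg).
Proof. exact (is_derive_plus (K:=C_AbsRing) (V:=C_NormedModule) f g z df dg). Qed.

Lemma Cderiv_opp f z df : Cderiv f z df -> Cderiv (fun y => - f y) z (- df).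
Proof. exact (is_derive_opp (K:=C_AbsRing) (V:=C_NormedModule) f z df). Qed.

Lemma Cderiv_minus f g z df dg : Cderiv f z df -> Cderiv g z dg ->
  Cderiv (fun y => f y - g y) z (df - dg).
Proof. intros hf hg. apply Cderiv_plus, Cderiv_opp; assumption. Qed.

Lemma Cderiv_id z : Cderiv (fun y => y) z 1.
Proof. apply Cderiv_AbsRing. exact (is_derive_id (K:=C_AbsRing) z). Qed.

Lemma Cderiv_const c z : Cderiv (fun y => c) z 0.
Proof. exact (is_derive_const (K:=C_AbsRing) (V:=C_NormedModule) c z). Qed.

Lemma Cderiv_value f z l l' : Cderiv f z l -> l = l' -> Cderiv f z l'.
Proof. intros h <-; exact h. Qed.

Lemma Cderiv_unique f z l l' : Cderiv f z l -> Cderiv f z l' -> l = l'.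
Proof.
intros h h'. rewrite <- (is_C_derive_unique f z l h). exact (is_C_derive_unique f z l' h').
Qed.

Lemma Cderiv_local f g z l (d : R) : (0 < d)%R ->
  (forall y, (Cmod (y - z) < d)%R -> f y = g y) -> Cderiv f z l -> Cderiv g z l.
Proof.
intros hd hfg. apply is_derive_ext_loc.
exists (mkposreal d hd). intros y hy. exact (hfg y hy).
Qed.

Lemma Cderiv_scal (c : C) f z df : Cderiv f z df -> Cderiv (fun y => c * f y) z (c * df).
Proof.
intros hf. eapply Cderiv_value; [apply Cderiv_mult; [apply Cderiv_const | exact hf]|].
simpl; ring.
Qed.

Lemma Cderiv_disk_ext f g z l : in_disk z ->
  (forall y, in_disk y -> f y = g y) -> Cderiv f z l -> Cderiv g z l.
Proof.
unfold in_disk; intros hz hfg. apply (Cderiv_local _ _ _ _ (1 - Cmod z)); [lra|].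
intros y hy. apply hfg.
replace y with ((y - z) + z) by ring.
eapply Rle_lt_trans; [apply Cmod_triangle | lra].
Qed.

Lemma Cderiv_inv (z : C) : z <> 0 -> Cderiv (fun y => / y) z (- / (z * z)).
Proof.
intros hz. apply Cderiv_eps. intros eps he.
assert (hm : (0 < Cmod z)%R) by (apply Cmod_gt_0; exact hz).
set (m := Cmod z) in *.
(* The error is |y - z|^2 / (|y| m^2). The first radius gives |y| >= m / 2, and the second then
   bounds |y - z| / (|y| m^2) by eps. *)
exists (Rmin (m / 2) (eps * (m * m * m) / 2)). split.
{ apply Rmin_glb_lt; [lra|].
  assert (0 < m * m * m)%R by (repeat apply Rmult_lt_0_compat; lra). nra. }
intros y hy.
assert (h1 := Rlt_le_trans _ _ _ hy (Rmin_l _ _)).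
assert (h2 := Rlt_le_trans _ _ _ hy (Rmin_r _ _)).
assert (hy2 : (m / 2 <= Cmod y)%R).
{ assert (m <= Cmod (y - z) + Cmod y)%R.
  { unfold m. replace z with (- (y - z) + y) at 1 by ring.
    eapply Rle_trans; [apply Cmod_triangle|]. rewrite Cmod_opp. lra. }
  lra. }
assert (y <> 0) by (intros ->; rewrite Cmod_0 in hy2; lra).
replace (/ y - / z - (y - z) * - / (z * z)) with ((y - z) * ((y - z) * / (y * (z * z))))
  by (field; split; assumption).
assert (z * z <> 0) by (apply Cmult_neq_0; assumption).
rewrite !Cmod_mult, Cmod_inv, !Cmod_mult by (apply Cmult_neq_0; assumption).
fold m. rewrite Rmult_comm.
apply Rmult_le_compat_r; [apply Cmod_ge_0|].
apply (Rmult_le_reg_r (Cmod y * (m * m))); [apply Rmult_lt_0_compat; nra|].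
rewrite Rmult_assoc, Rinv_l, Rmult_1_r.
2: { apply Rgt_not_eq. apply Rmult_lt_0_compat; nra. }
assert (0 < m * m)%R by nra.
assert (m / 2 * (m * m) <= Cmod y * (m * m))%R by (apply Rmult_le_compat_r; lra).
nra.
Qed.

Lemma Cderiv_div f g z df dg : Cderiv f z df -> Cderiv g z dg -> g z <> 0 ->
  Cderiv (fun y => f y / g y) z ((df * g z - f z * dg) / (g z * g z)).
Proof.
intros hf hg hz. eapply Cderiv_value.
- apply Cderiv_mult; [exact hf|].
  apply (Cderiv_comp (fun y => / y) g); [apply Cderiv_inv; exact hz | exact hg].
- simpl. field. exact hz.
Qed.

(** * Holomorphic functions along real paths *)

Lemma Cmod_le_Re_Im z : (Cmod z <= Rabs (Re z) + Rabs (Im z))%R.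
Proof.
destruct z as [x y]. simpl.
replace (x, y) with (RtoC x + RtoC y * Ci) by (unfold RtoC, Cplus, Cmult, Ci; simpl; f_equal; ring).
eapply Rle_trans; [apply Cmod_triangle|].
rewrite Cmod_mult, Cmod_Ci, !Cmod_R. lra.
Qed.

Lemma im_le_Cmod z : (Rabs (Im z) <= Cmod z)%R.
Proof.
eapply Rle_trans; [apply Rmax_r | apply (Rmax_Cmod z)].
Qed.

Lemma is_derive_R_eps (f : R -> R) (t l : R) : is_derive f t l <->
  forall eps : R, (0 < eps)%R -> exists del : R, (0 < del)%R /\
    forall s, (Rabs (s - t) < del)%R ->
      (Rabs (f s - f t - (s - t) * l) <= eps * Rabs (s - t))%R.
Proof.
split.
- intros [_ H] eps he.
  destruct (H t (fun P h => h) (mkposreal eps he)) as [d hd].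
  exists d; split; [apply cond_pos|].
  intros y hy. exact (hd y hy).
- intros H. split.
  + apply is_linear_scal_l.
  + intros x hx.
    assert (E : t = x) by exact (is_filter_lim_locally_unique (V:=AbsRing_NormedModule R_AbsRing) t x hx).
    subst x. intros [eps he].
    destruct (H eps he) as [d [hd Hd]].
    exists (mkposreal d hd). intros y hy. exact (Hd y hy).
Qed.

(** A chain rule across two base fields: [f] is differentiated over C and the path over R, so the
    error is estimated by hand as the error of [f] plus [l] times the error of the path. *)
Lemma Cderiv_path_Re f (g : R -> C) t l dg :
  Cderiv f (g t) l ->
  is_derive (fun s => Re (g s)) t (Re dg) ->
  is_derive (fun s => Im (g s)) t (Im dg) ->
  is_derive (fun s => Re (f (g s))) t (Re (dg * l)).
Proof.
rewrite Cderiv_eps, !is_derive_R_eps. intros hf hx hy eps he.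
assert (hl := Cmod_ge_0 l). assert (hg := Cmod_ge_0 dg).
(* Each error gets half of eps. The path error is at most 2 e1 |s - t| and is multiplied by |l|;
   since e1 <= 1, the path has Lipschitz constant |dg| + 2 at t, which is the factor compensated in
   [e2]. *)
set (e1 := Rmin 1 (eps / (4 * (Cmod l + 1)))).
assert (he1 : (0 < e1)%R).
{ apply Rmin_glb_lt; [lra|]. apply Rdiv_lt_0_compat; lra. }
set (e2 := (eps / (2 * (Cmod dg + 2)))%R).
assert (he2 : (0 < e2)%R) by (apply Rdiv_lt_0_compat; lra).
destruct (hf e2 he2) as [d0 [hd0 H0]].
destruct (hx e1 he1) as [d1 [hd1 H1]].
destruct (hy e1 he1) as [d2 [hd2 H2]].
set (d3 := (d0 / (Cmod dg + 2))%R).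
assert (hd3 : (0 < d3)%R) by (apply Rdiv_lt_0_compat; lra).
exists (Rmin d3 (Rmin d1 d2)). split; [repeat apply Rmin_glb_lt; assumption|].
intros s hs.
assert (hs3 := Rlt_le_trans _ _ _ hs (Rmin_l _ _)).
assert (hs' := Rlt_le_trans _ _ _ hs (Rmin_r _ _)).
specialize (H1 s (Rlt_le_trans _ _ _ hs' (Rmin_l _ _))).
specialize (H2 s (Rlt_le_trans _ _ _ hs' (Rmin_r _ _))).
assert (He : (Cmod (g s - g t - (s - t)%R * dg) <= 2 * e1 * Rabs (s - t))%R).
{ eapply Rle_trans; [apply Cmod_le_Re_Im|].
  replace (Re (g s - g t - (s - t)%R * dg)) with (Re (g s) - Re (g t) - (s - t) * Re dg)%R
    by (unfold Re, Cminus, Cplus, Copp, Cmult, RtoC; simpl; ring).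
  replace (Im (g s - g t - (s - t)%R * dg)) with (Im (g s) - Im (g t) - (s - t) * Im dg)%R
    by (unfold Im, Cminus, Cplus, Copp, Cmult, RtoC; simpl; ring).
  lra. }
assert (hb1 : (e1 <= 1)%R) by apply Rmin_l.
assert (hb2 : (e1 * (4 * (Cmod l + 1)) <= eps)%R).
{ apply (Rmult_le_reg_r (/ (4 * (Cmod l + 1)))); [apply Rinv_0_lt_compat; lra|].
  rewrite Rmult_assoc, Rinv_r, Rmult_1_r by lra. apply Rmin_r. }
assert (hb3 : (e2 * (2 * (Cmod dg + 2)) = eps)%R) by (unfold e2; field; lra).
assert (hb4 : (d3 * (Cmod dg + 2) = d0)%R) by (unfold d3; field; lra).
assert (hst := Rabs_pos (s - t)).
assert (Hg : (Cmod (g s - g t) <= (Cmod dg + 2) * Rabs (s - t))%R).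
{ replace (g s - g t) with ((g s - g t - (s - t)%R * dg) + (s - t)%R * dg) by ring.
  eapply Rle_trans; [apply Cmod_triangle|]. rewrite Cmod_mult, Cmod_R. nra. }
assert (Hf := H0 (g s)).
assert (hlt : (Cmod (g s - g t) < d0)%R).
{ eapply Rle_lt_trans; [exact Hg|]. rewrite <- hb4, Rmult_comm. apply Rmult_lt_compat_r; lra. }
specialize (Hf hlt).
replace (Re (f (g s)) - Re (f (g t)) - (s - t) * Re (dg * l))%R
  with (Re ((f (g s) - f (g t) - (g s - g t) * l) + (g s - g t - (s - t)%R * dg) * l))
  by (unfold Re, Im, Cminus, Cplus, Copp, Cmult, RtoC; simpl; ring).
eapply Rle_trans; [apply re_le_Cmod|].
eapply Rle_trans; [apply Cmod_triangle|].
rewrite Cmod_mult.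
assert (Cmod (g s - g t - (s - t)%R * dg) * Cmod l <= 2 * e1 * Rabs (s - t) * Cmod l)%R
  by (apply Rmult_le_compat_r; assumption).
assert (e2 * Cmod (g s - g t) <= e2 * ((Cmod dg + 2) * Rabs (s - t)))%R
  by (apply Rmult_le_compat_l; lra).
assert (2 * e1 * Cmod l <= eps / 2)%R by nra.
assert (2 * e1 * Rabs (s - t) * Cmod l <= eps / 2 * Rabs (s - t))%R by nra.
nra.
Qed.

(** Multiplication by [- Ci] turns the imaginary part into a real part, which reduces this to the
    previous lemma. *)
Lemma Cderiv_path_Im f (g : R -> C) t l dg :
  Cderiv f (g t) l ->
  is_derive (fun s => Re (g s)) t (Re dg) ->
  is_derive (fun s => Im (g s)) t (Im dg) ->
  is_derive (fun s => Im (f (g s))) t (Im (dg * l)).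
Proof.
intros hf hx hy.
assert (H : Cderiv (fun y => - Ci * f y) (g t) (- Ci * l)) by (apply Cderiv_scal; exact hf).
assert (K := Cderiv_path_Re _ g t _ dg H hx hy).
replace (Im (dg * l)) with (Re (dg * (- Ci * l)))
  by (unfold Re, Im, Copp, Cmult, Ci; simpl; ring).
eapply is_derive_ext; [|exact K].
intros s. unfold Re, Im, Copp, Cmult, Ci; simpl; ring.
Qed.

Lemma segment_derive (z : C) (t : R) :
  is_derive (fun s => Re (RtoC s * z)) t (Re z) /\
  is_derive (fun s => Im (RtoC s * z)) t (Im z).
Proof.
destruct z as [x y]; simpl. split; auto_derive; trivial; ring.
Qed.

(* The real mean value inequality, applied to the component of the increment
   in its own direction. *)
Lemma Cderiv_mean_value f df (D : R) z :
  (forall t : R, (0 <= t <= 1)%R -> Cderiv f (t * z) (df (t * z)) /\ (Cmod (df (t * z)%C) <= D)%R) ->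
  (Cmod (f z - f 0) <= D * Cmod z)%R.
Proof.
intros H.
set (d := f z - f 0).
destruct (Req_dec (Cmod d) 0) as [h0|h0].
{ rewrite h0. apply Rmult_le_pos; [|apply Cmod_ge_0].
  eapply Rle_trans; [apply Cmod_ge_0 | apply (H 0%R); lra]. }
assert (hd : (0 < Cmod d)%R) by (generalize (Cmod_ge_0 d); lra).
set (phi := fun s : R => Re (Cconj d * f (s * z))).
assert (Hphi : forall t, (0 <= t <= 1)%R -> is_derive phi t (Re (z * (Cconj d * df (t * z))))).
{ intros t ht. destruct (H t ht) as [h1 _]. destruct (segment_derive z t) as [hx hy].
  apply (Cderiv_path_Re (fun y => Cconj d * f y) (fun s => RtoC s * z)); try assumption.
  apply Cderiv_scal; exact h1. }
destruct (MVT_gen phi 0 1 (fun t => Re (z * (Cconj d * df (t * z))))) as [c [hc E]].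
{ intros t ht. rewrite Rmin_left, Rmax_right in ht by lra. apply Hphi. lra. }
{ intros t ht. rewrite Rmin_left, Rmax_right in ht by lra.
  apply derivable_continuous_pt. eexists. apply is_derive_Reals, Hphi. exact ht. }
rewrite Rmin_left, Rmax_right in hc by lra.
assert (E1 : (phi 1 - phi 0 = Cmod d * Cmod d)%R).
{ unfold phi. rewrite Cmult_1_l, Cmult_0_l.
  replace (Re (Cconj d * f z) - Re (Cconj d * f 0))%R with (Re (d * Cconj d)).
  - rewrite <- Cmod2_conj. simpl. ring.
  - unfold d at 1. unfold Re, Cminus, Cplus, Copp, Cmult, Cconj; simpl; ring. }
rewrite E1 in E.
destruct (H c hc) as [_ h2].
assert (h3 := re_le_Cmod (z * (Cconj d * df (c * z)))).
rewrite !Cmod_mult, Cmod_conj in h3.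
assert (h4 := Rle_abs (Re (z * (Cconj d * df (c * z))))).
assert (Cmod z * (Cmod d * Cmod (df (c * z)%C)) <= Cmod z * (Cmod d * D))%R.
{ apply Rmult_le_compat_l; [apply Cmod_ge_0|]. apply Rmult_le_compat_l; [apply Cmod_ge_0|exact h2]. }
apply (Rmult_le_reg_l (Cmod d)); [exact hd|]. nra.
Qed.

(** Serves to prove identities between holomorphic functions: the logarithm against its series, and
    the product of two solutions of opposite differential equations. *)
Lemma Cderiv_zero_const f z : in_disk z ->
  (forall y, in_disk y -> Cderiv f y 0) -> f z = f 0.
Proof.
intros hz H.
apply Ceq_minus, Cmod_eq_0. apply Rle_antisym; [|apply Cmod_ge_0].
enough (Cmod (f z - f 0)%C <= 0 * Cmod z)%R by lra.
apply (Cderiv_mean_value f (fun _ => 0)).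
intros t ht. rewrite Cmod_0. split; [|lra].
apply H. unfold in_disk in *. rewrite Cmod_mult, Cmod_R, Rabs_pos_eq by lra.
generalize (Cmod_ge_0 z). nra.
Qed.

(** * Circle means *)

Notation Ccontinuous := (@continuous C_UniformSpace C_UniformSpace).

(** Differentiability speaks of modulus balls and [Ccontinuous] of the product balls of R * R, the
    ones that real integrals need; [locally_C] says that both give the same neighbourhoods. *)
Lemma Cderiv_continuous f z l : Cderiv f z l -> Ccontinuous f z.
Proof.
intros h P hP.
assert (K : @continuous (AbsRing_UniformSpace C_AbsRing) C_UniformSpace f z).
{ apply (ex_derive_continuous (K := C_AbsRing) (V := C_NormedModule)). exists l; exact h. }
apply locally_C. exact (K P hP).
Qed.

Definition polar (r t : R) : C := (r * cos t, r * sin t)%R.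

Lemma Cmod_polar r t : (0 <= r)%R -> Cmod (polar r t) = r.
Proof.
intros hr. unfold Cmod, polar; simpl.
replace (r * cos t * (r * cos t * 1) + r * sin t * (r * sin t * 1))%R
  with (r * r * (Rsqr (sin t) + Rsqr (cos t)))%R by (unfold Rsqr; ring).
rewrite sin2_cos2, Rmult_1_r. apply sqrt_square; exact hr.
Qed.

Lemma polar_derive_radius (r t : R) :
  is_derive (fun s => Re (polar s t)) r (Re (polar 1 t)) /\
  is_derive (fun s => Im (polar s t)) r (Im (polar 1 t)).
Proof. unfold polar; simpl. split; auto_derive; trivial; ring. Qed.

Lemma polar_derive_angle (r t : R) :
  is_derive (fun s => Re (polar r s)) t (Re (Ci * polar r t)) /\
  is_derive (fun s => Im (polar r s)) t (Im (Ci * polar r t)).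
Proof. unfold polar; simpl. split; auto_derive; trivial; ring. Qed.

Lemma continuous_polar (u v : R) :
  @continuous (prod_UniformSpace R_UniformSpace R_UniformSpace) C_UniformSpace
    (fun p => polar (fst p) (snd p)) (u, v).
Proof.
assert (hu : continuous (fun p : R * R => fst p) (u, v)) by apply continuous_fst.
assert (hv : continuous (fun p : R * R => snd p) (u, v)) by apply continuous_snd.
assert (hc : continuous (fun p : R * R => cos (snd p)) (u, v)).
{ apply (continuous_comp snd cos); [exact hv|]. apply continuous_cos. }
assert (hs : continuous (fun p : R * R => sin (snd p)) (u, v)).
{ apply (continuous_comp snd sin); [exact hv|]. apply continuous_sin. }
assert (h1 := continuous_mult (K := R_AbsRing) _ _ _ hu hc).
assert (h2 := continuous_mult (K := R_AbsRing) _ _ _ hu hs).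
apply (continuous_comp_2 (fun p : R * R => fst p * cos (snd p))%R
  (fun p : R * R => fst p * sin (snd p))%R (fun x y : R => (x, y) : C_UniformSpace)
  (u, v) h1 h2).
apply (continuous_ext (fun p : R * R => p)); [intros [x y]; reflexivity|].
apply continuous_id.
Qed.

Lemma continuous_Re (f : R * R -> C) p :
  @continuous (prod_UniformSpace R_UniformSpace R_UniformSpace) C_UniformSpace f p ->
  continuous (fun q => Re (f q)) p.
Proof. intros h. apply (continuous_comp f (fun z : C_UniformSpace => Re z)); [exact h | apply continuous_fst]. Qed.

Lemma continuous_Im (f : R * R -> C) p :
  @continuous (prod_UniformSpace R_UniformSpace R_UniformSpace) C_UniformSpace f p ->
  continuous (fun q => Im (f q)) p.
Proof. intros h. apply (continuous_comp f (fun z : C_UniformSpace => Im z)); [exact h | apply continuous_snd]. Qed.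

Lemma continuous_Re_mult (f g : R * R -> C) p :
  @continuous (prod_UniformSpace R_UniformSpace R_UniformSpace) C_UniformSpace f p ->
  @continuous (prod_UniformSpace R_UniformSpace R_UniformSpace) C_UniformSpace g p ->
  continuous (fun q => Re (f q * g q)) p.
Proof.
intros hf hg.
apply (continuous_ext (fun q => Re (f q) * Re (g q) - Im (f q) * Im (g q))%R).
{ intros q. rewrite re_mult. reflexivity. }
apply (continuous_minus (V := R_NormedModule)); apply (continuous_mult (K := R_AbsRing)).
- apply continuous_Re; exact hf.
- apply continuous_Re; exact hg.
- apply continuous_Im; exact hf.
- apply continuous_Im; exact hg.
Qed.

Section CircleMean.

Variables H dH : C -> C.
Hypothesis H_deriv : forall z, (0 < Cmod z < 1)%R -> Cderiv H z (dH z).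
Hypothesis dH_cont : forall z, (0 < Cmod z < 1)%R -> Ccontinuous dH z.

Let mean (r : R) : R := RInt (fun t => Re (H (polar r t))) 0 (2 * PI).

Lemma radial_derive (r t : R) : (0 < r < 1)%R ->
  is_derive (fun s => Re (H (polar s t))) r (Re (polar 1 t * dH (polar r t))).
Proof.
intros hr. destruct (polar_derive_radius r t) as [hx hy].
apply (Cderiv_path_Re H (fun s => polar s t)); try assumption.
apply H_deriv. rewrite Cmod_polar; lra.
Qed.

(* Cauchy-Riemann in polar coordinates. *)
Lemma angular_derive (r t : R) : (0 < r < 1)%R ->
  is_derive (fun s => Im (H (polar r s)) / r)%R t (Re (polar 1 t * dH (polar r t))).
Proof.
intros hr. destruct (polar_derive_angle r t) as [hx hy].
assert (K : is_derive (fun s => Im (H (polar r s))) t (Im (Ci * polar r t * dH (polar r t)))).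
{ apply (Cderiv_path_Im H (fun s => polar r s)); try assumption.
  apply H_deriv. rewrite Cmod_polar; lra. }
apply (is_derive_scal _ _ (/ r)) in K.
replace (Re (polar 1 t * dH (polar r t))) with
  (/ r * Im (Ci * polar r t * dH (polar r t)))%R.
- eapply is_derive_ext; [|exact K]. intros s; simpl. unfold Rdiv; ring.
- unfold polar, Re, Im, Cmult, Ci; simpl. field. lra.
Qed.

(** Joint continuity in radius and angle is what differentiation under the integral asks for; here
    the continuity of [dH] enters. *)
Lemma continuous_radial_derivative (r t : R) : (0 < r < 1)%R ->
  @continuous (prod_UniformSpace R_UniformSpace R_UniformSpace) R_UniformSpace
    (fun p => Re (polar 1 (snd p) * dH (polar (fst p) (snd p)))) (r, t).
Proof.
intros hr. apply continuous_Re_mult.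
- apply (continuous_comp_2 (fun _ : R * R => 1%R) snd (fun u v => polar u v : C_UniformSpace)).
  + apply continuous_const.
  + apply continuous_snd.
  + apply continuous_polar.
- apply (continuous_comp (fun p : R * R => polar (fst p) (snd p) : C_UniformSpace) (dH : C_UniformSpace -> C_UniformSpace)).
  + apply continuous_polar.
  + apply dH_cont. simpl. rewrite Cmod_polar; lra.
Qed.

Lemma continuous_circle (r t : R) : (0 < r < 1)%R ->
  continuous (fun s => Re (H (polar r s))) t.
Proof.
intros hr. apply (ex_derive_continuous (K := R_AbsRing) (V := R_NormedModule)).
destruct (polar_derive_angle r t) as [hx hy].
eexists. apply (Cderiv_path_Re H (fun s => polar r s)); try eassumption.
apply H_deriv. rewrite Cmod_polar; lra.
Qed.

Lemma near_radius (r : R) : (0 < r < 1)%R -> locally r (fun s : R => (0 < s < 1)%R).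
Proof.
intros hr. exists (mkposreal (Rmin r (1 - r)) ltac:(apply Rmin_glb_lt; lra)).
intros s hs. change (Rabs (s - r) < Rmin r (1 - r))%R in hs.
assert (h1 := Rlt_le_trans _ _ _ hs (Rmin_l _ _)).
assert (h2 := Rlt_le_trans _ _ _ hs (Rmin_r _ _)).
apply Rabs_def2 in h1. apply Rabs_def2 in h2. lra.
Qed.

(** [radial_derive] and [angular_derive] have the same right-hand side. So the integrand obtained
    under the integral is also the t-derivative of the periodic function [Im (H (polar r t)) / r],
    and it integrates to 0 over a period. *)
Lemma circle_mean_derive (r : R) : (0 < r < 1)%R -> is_derive mean r 0%R.
Proof.
intros hr.
replace 0%R with (RInt (fun t => Derive (fun u : R => Re (H (polar u t))) r) 0 (2 * PI)).
- apply (is_derive_RInt_param (fun u t => Re (H (polar u t)))).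
  + apply (filter_imp (fun s : R => (0 < s < 1)%R)); [|apply near_radius; exact hr].
    intros s hs t _. eexists. apply radial_derive; exact hs.
  + intros t _.
    apply continuity_2d_pt_ext_loc with
      (f := fun u v => Re (polar 1 v * dH (polar u v))).
    * destruct (near_radius r hr) as [d hd]. exists d. intros u v hu hv.
      symmetry. apply is_derive_unique, radial_derive. apply hd. exact hu.
    * apply continuity_2d_pt_filterlim.
      exact (continuous_radial_derivative r t hr).
  + apply (filter_imp (fun s : R => (0 < s < 1)%R)); [|apply near_radius; exact hr].
    intros s hs. apply (ex_RInt_continuous (V := R_CompleteNormedModule)).
    intros t _. apply continuous_circle; exact hs.
- apply is_RInt_unique.
  apply (is_RInt_ext (fun t => Re (polar 1 t * dH (polar r t)))).
  { intros t _. symmetry. apply is_derive_unique, radial_derive; exact hr. }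
  assert (K := is_RInt_derive (V := R_CompleteNormedModule) (fun s => Im (H (polar r s)) / r)%R
    (fun t => Re (polar 1 t * dH (polar r t))) 0 (2 * PI)).
  replace 0%R with (minus (Im (H (polar r (2 * PI))) / r) (Im (H (polar r 0)) / r))%R at 2.
  + apply K.
    * intros t _. apply angular_derive; exact hr.
    * intros t _.
      apply (continuous_comp_2 (fun _ : R => r) (fun s : R => s)
        (fun u v => Re (polar 1 v * dH (polar u v)))).
      -- apply continuous_const.
      -- apply continuous_id.
      -- apply continuous_radial_derivative; exact hr.
  + replace (polar r (2 * PI)) with (polar r 0).
    * unfold minus, plus, opp; simpl. ring.
    * unfold polar. rewrite cos_2PI, sin_2PI, cos_0, sin_0. reflexivity.
Qed.

Lemma circle_mean_const (r s : R) : (0 < r < 1)%R -> (0 < s < 1)%R -> mean r = mean s.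
Proof.
intros hr hs.
destruct (MVT_gen mean r s (fun _ => 0%R)) as [c [_ E]].
- intros x hx. apply circle_mean_derive.
  destruct (Rle_dec r s); [rewrite Rmin_left, Rmax_right in hx | rewrite Rmin_right, Rmax_left in hx]; lra.
- intros x hx. apply derivable_continuous_pt. eexists. apply is_derive_Reals, circle_mean_derive.
  destruct (Rle_dec r s); [rewrite Rmin_left, Rmax_right in hx | rewrite Rmin_right, Rmax_left in hx]; lra.
- lra.
Qed.

(** The mean can be computed on an arbitrarily small circle, where [H] is small by hypothesis. *)
Lemma circle_mean_zero (r : R) : (0 < r < 1)%R ->
  (forall eps : R, (0 < eps)%R -> exists del : R, (0 < del)%R /\
     forall z, (0 < Cmod z < del)%R -> (Cmod (H z) <= eps)%R) ->
  is_RInt (fun t => Re (H (polar r t))) 0 (2 * PI) 0%R.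
Proof.
intros hr hlim.
assert (hI : forall s, (0 < s < 1)%R -> ex_RInt (fun t => Re (H (polar s t))) 0 (2 * PI)).
{ intros s hs. apply (ex_RInt_continuous (V := R_CompleteNormedModule)).
  intros t _. apply continuous_circle; exact hs. }
assert (hpi := PI_RGT_0).
assert (E : mean r = 0%R).
{ apply cond_eq. intros eps he. rewrite Rminus_0_r.
  (* The circle has length 2 PI in t, so this choice bounds the mean by eps / 2, strictly below
     eps. *)
  destruct (hlim (eps / (4 * PI))%R) as [d [hd Hd]]; [apply Rdiv_lt_0_compat; lra|].
  set (s := Rmin (1 / 2) (d / 2)).
  assert (hs : (0 < s < 1)%R).
  { split; [apply Rmin_glb_lt; lra|]. eapply Rle_lt_trans; [apply Rmin_l|lra]. }
  assert (hsd : (s < d)%R) by (eapply Rle_lt_trans; [apply Rmin_r|lra]).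
  rewrite (circle_mean_const r s hr hs).
  apply Rle_lt_trans with ((2 * PI - 0) * (eps / (4 * PI)))%R.
  - unfold mean. apply (abs_RInt_le_const _ 0 (2 * PI)); [lra | apply hI; exact hs |].
    intros t _. eapply Rle_trans; [apply re_le_Cmod|]. apply Hd. rewrite Cmod_polar; lra.
  - replace ((2 * PI - 0) * (eps / (4 * PI)))%R with (eps / 2)%R by (field; lra). lra. }
assert (K := RInt_correct (V := R_CompleteNormedModule) _ _ _ (hI r hr)).
change (is_RInt (fun t => Re (H (polar r t))) 0 (2 * PI) (mean r)) in K.
rewrite E in K. exact K.
Qed.

End CircleMean.

(** * Bessel inequality for the first two Taylor coefficients *)

Lemma Ccontinuous_plus f g z : Ccontinuous f z -> Ccontinuous g z ->
  Ccontinuous (fun y => f y + g y) z.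
Proof. exact (continuous_plus (V := C_R_NormedModule) f g z). Qed.

Lemma Ccontinuous_mult f g z : Ccontinuous f z -> Ccontinuous g z ->
  Ccontinuous (fun y => f y * g y) z.
Proof.
intros hf hg.
apply (continuous_ext (T := C_UniformSpace) (U := C_UniformSpace)
  (fun y => (Re (f y * g y), Re (f y * (- Ci * g y))) : C)).
{ intros y. destruct (f y), (g y). unfold Re, Cmult, Copp, Ci; simpl. f_equal; ring. }
apply (continuous_comp_2 (fun y : C_UniformSpace => Re (f y * g y))
  (fun y : C_UniformSpace => Re (f y * (- Ci * g y)))
  (fun x y : R => (x, y) : C_UniformSpace)).
- exact (continuous_Re_mult f g z hf hg).
- apply (continuous_Re_mult f (fun y => - Ci * g y) z hf).
  apply (continuous_comp (g : C_UniformSpace -> C_UniformSpace) (fun y => - Ci * y : C_UniformSpace)).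
  + exact hg.
  + eapply Cderiv_continuous, Cderiv_scal, Cderiv_id.
- apply (continuous_ext (fun p : R * R => p)); [intros [x y]; reflexivity|].
  apply continuous_id.
Qed.

Section Bessel.

Variables (w v : C -> C) (c1 c2 : C).
Hypothesis w_deriv : forall z, in_disk z -> Cderiv w z (v z).
Hypothesis v_cont : forall z, in_disk z -> Ccontinuous v z.
Hypothesis w_disk : forall z, in_disk z -> in_disk (w z).
Hypothesis w_0 : w 0 = 0.
Hypothesis v_0 : v 0 = c1.
Hypothesis v_deriv_0 : Cderiv v 0 (2 * c2).

Let P (z : C) : C := c1 * z + c2 * (z * z).
Let E (z : C) : C := w z - P z.
Let dE (z : C) : C := v z - (c1 + 2 * c2 * z).

Lemma taylor_remainder_derive z : in_disk z -> Cderiv E z (dE z).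
Proof.
intros hz. apply Cderiv_minus; [apply w_deriv; exact hz|].
eapply Cderiv_value.
- apply Cderiv_plus; apply Cderiv_scal; [|apply Cderiv_mult]; apply Cderiv_id.
- simpl. ring.
Qed.

(** Differentiability of [v] at 0 makes [dE] an o(|z|), and the mean value inequality on the segment
    from 0 to z gains one more factor |z|. *)
Lemma taylor_remainder_small (eps : R) : (0 < eps)%R -> exists del : R, (0 < del <= 1)%R /\
  forall z, (Cmod z < del)%R -> (Cmod (E z) <= eps * (Cmod z * Cmod z))%R.
Proof.
intros he.
destruct (proj1 (Cderiv_eps v 0 (2 * c2)) v_deriv_0 eps he) as [d [hd Hd]].
exists (Rmin d 1). split; [split; [apply Rmin_glb_lt; lra | apply Rmin_r]|].
intros z hz.
assert (hzd := Rlt_le_trans _ _ _ hz (Rmin_l _ _)).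
assert (hz1 := Rlt_le_trans _ _ _ hz (Rmin_r _ _)).
replace (E z) with (E z - E 0) by (unfold E, P; rewrite w_0; ring).
rewrite <- Rmult_assoc.
apply (Cderiv_mean_value E dE).
intros t ht.
assert (hm : (Cmod (t * z) <= Cmod z)%R).
{ rewrite Cmod_mult, Cmod_R, Rabs_pos_eq by lra. generalize (Cmod_ge_0 z). nra. }
split; [apply taylor_remainder_derive; unfold in_disk; lra|].
specialize (Hd (t * z)). rewrite v_0 in Hd.
replace (t * z - 0) with (t * z) in Hd by ring.
replace (dE (t * z)) with (v (t * z) - c1 - t * z * (2 * c2)) by (unfold dE; ring).
eapply Rle_trans; [apply Hd; lra|]. apply Rmult_le_compat_l; lra.
Qed.

(** The conjugate of [P] on the circle of radius [r], rewritten by conj z = r^2 / z as a function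
    holomorphic off 0. The parameter [r] stays frozen while the circle of integration shrinks to
    0. *)
Let K (r : R) (z : C) : C := Cconj c1 * (r * r)%R / z + Cconj c2 * (r * r * (r * r))%R / (z * z).

Lemma Cinv_conj_circle (r t : R) : (0 < r)%R ->
  / polar r t = Cconj (polar r t) * (/ (r * r))%R.
Proof.
intros hr.
assert (hz : polar r t <> 0) by (apply Cmod_gt_0; rewrite Cmod_polar; lra).
assert (hrr : RtoC r <> 0) by (intros h; apply RtoC_inj in h; lra).
assert (h := Cmod2_conj (polar r t)). rewrite Cmod_polar in h by lra.
rewrite RtoC_inv by nra. rewrite RtoC_mult.
replace (RtoC (r ^ 2)) with (RtoC r * RtoC r) in h by (rewrite <- RtoC_mult; f_equal; ring).
rewrite h. field. split; [|exact hz].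
intros h'. rewrite h' in h. apply (Cmult_neq_0 _ _ hrr hrr). rewrite h. ring.
Qed.

Lemma kernel_conj (r t : R) : (0 < r)%R -> K r (polar r t) = Cconj (P (polar r t)).
Proof.
intros hr. unfold K, P, Cdiv.
assert (hz : polar r t <> 0) by (apply Cmod_gt_0; rewrite Cmod_polar; lra).
assert (hrr : RtoC r <> 0) by (intros h; apply RtoC_inj in h; lra).
replace (/ (polar r t * polar r t)) with (/ polar r t * / polar r t) by (field; exact hz).
rewrite Cinv_conj_circle by exact hr.
rewrite Cplus_conj, !Cmult_conj, RtoC_inv, !RtoC_mult by nra.
field. exact hrr.
Qed.

(** The double pole of the kernel is beaten by the o(|z|^2) of the remainder, so the product tends
    to 0 at the origin and [circle_mean_zero] applies. *)
Lemma kernel_orthogonal (r : R) : (0 < r < 1)%R ->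
  is_RInt (fun t => Re (E (polar r t) * K r (polar r t))) 0 (2 * PI) 0%R.
Proof.
intros hr.
set (A := Cconj c1 * (r * r)%R). set (B := Cconj c2 * (r * r * (r * r))%R).
set (dK := fun z : C => - A * / (z * z) - 2 * B * / (z * z * z)).
assert (hK : forall z : C, z <> 0 -> Cderiv (K r) z (dK z)).
{ intros z hz. unfold K, dK. fold A B. eapply Cderiv_value.
  - apply Cderiv_plus.
    + apply Cderiv_scal, Cderiv_inv; exact hz.
    + apply Cderiv_scal. apply (Cderiv_comp (fun y => / y) (fun y => y * y)).
      * apply Cderiv_inv. apply Cmult_neq_0; exact hz.
      * apply Cderiv_mult; apply Cderiv_id.
  - simpl. field. exact hz. }
assert (hdK : forall z : C, z <> 0 -> Ccontinuous dK z).
{ intros z hz. unfold dK.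
  eapply Cderiv_continuous, Cderiv_minus; apply Cderiv_scal.
  - apply (Cderiv_comp (fun y => / y) (fun y => y * y)).
    + apply Cderiv_inv. apply Cmult_neq_0; exact hz.
    + apply Cderiv_mult; apply Cderiv_id.
  - apply (Cderiv_comp (fun y => / y) (fun y => y * y * y)).
    + apply Cderiv_inv. repeat apply Cmult_neq_0; exact hz.
    + apply Cderiv_mult; [apply Cderiv_mult|]; apply Cderiv_id. }
assert (hnz : forall z : C, (0 < Cmod z < 1)%R -> z <> 0).
{ intros z hz. apply Cmod_gt_0. lra. }
apply (circle_mean_zero (fun z => E z * K r z) (fun z => dE z * K r z + E z * dK z)).
- intros z hz. apply Cderiv_mult.
  + apply taylor_remainder_derive. apply hz.
  + apply hK, hnz; exact hz.
- intros z hz. apply Ccontinuous_plus; apply Ccontinuous_mult.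
  + unfold dE. apply Ccontinuous_plus; [apply v_cont; apply hz|].
    eapply Cderiv_continuous, Cderiv_opp, Cderiv_plus;
      [apply Cderiv_const | apply Cderiv_scal, Cderiv_id].
  + eapply Cderiv_continuous, hK, hnz; exact hz.
  + eapply Cderiv_continuous, taylor_remainder_derive. apply hz.
  + apply hdK, hnz; exact hz.
- exact hr.
- intros eps he.
  assert (hA := Cmod_ge_0 A). assert (hB := Cmod_ge_0 B).
  (* For |z| < 1 the kernel is at most (|A| + |B|) / |z|^2; the summand 1 only avoids division by
     zero. *)
  set (eps' := (eps / (Cmod A + Cmod B + 1))%R).
  assert (he' : (0 < eps')%R) by (apply Rdiv_lt_0_compat; lra).
  assert (hee : (eps' * (Cmod A + Cmod B + 1) = eps)%R) by (unfold eps'; field; lra).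
  destruct (taylor_remainder_small eps' he') as [d [hd Hd]].
  exists d. split; [lra|]. intros z hz.
  assert (hz0 : z <> 0) by (apply Cmod_gt_0; lra).
  specialize (Hd z (proj2 hz)).
  assert (hKz : K r z = (A * z + B) / (z * z)) by (unfold K; fold A B; field; exact hz0).
  rewrite hKz, Cmod_mult, Cmod_div, Cmod_mult by (apply Cmult_neq_0; exact hz0).
  set (m := Cmod z) in *.
  assert (hAB : (Cmod (A * z + B) <= Cmod A + Cmod B)%R).
  { eapply Rle_trans; [apply Cmod_triangle|]. rewrite Cmod_mult. fold m. nra. }
  apply Rle_trans with (eps' * (m * m) * (Cmod (A * z + B) / (m * m)))%R.
  + apply Rmult_le_compat_r; [|exact Hd].
    apply Rmult_le_pos; [apply Cmod_ge_0|]. left. apply Rinv_0_lt_compat. nra.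
  + replace (eps' * (m * m) * (Cmod (A * z + B) / (m * m)))%R
      with (eps' * Cmod (A * z + B))%R by (field; lra).
    nra.
Qed.

(** Pointwise, |P|^2 + 2 Re (E conj P) <= |w|^2 <= 1, since the missing term |E|^2 is nonnegative.
    Over the circle the middle term vanishes by [kernel_orthogonal], and |P|^2 has mean [S]. *)
Lemma bessel_circle (r : R) : (0 < r < 1)%R ->
  (Cmod c1 ^ 2 * r ^ 2 + Cmod c2 ^ 2 * r ^ 4 <= 1)%R.
Proof.
intros hr.
assert (hpi := PI_RGT_0).
set (S := (Cmod c1 ^ 2 * r ^ 2 + Cmod c2 ^ 2 * r ^ 4)%R).
set (a := Re (c1 * Cconj c2)). set (b := Im (c1 * Cconj c2)).
assert (hP : forall t, (Cmod (P (polar r t)) ^ 2 = S + 2 * r ^ 3 * (a * cos t + b * sin t))%R).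
{ intros t. unfold S, a, b. rewrite !Cmod2_alt.
  assert (hsc := sin2_cos2 t). unfold Rsqr in hsc.
  destruct c1 as [x1 y1], c2 as [x2 y2]. unfold P, polar, Re, Im, Cplus, Cmult, Cconj; simpl.
  set (s := sin t) in *. set (c := cos t) in *.
  (* Inserting powers of s^2 + c^2 = 1 gives corresponding terms the same degree in s and c; the
     claim becomes a polynomial identity. *)
  replace ((x1 * (x1 * 1) + y1 * (y1 * 1)) * (r * (r * 1)))%R with
    ((x1 * x1 + y1 * y1) * (r * r) * (s * s + c * c))%R by (rewrite hsc; ring).
  replace ((x2 * (x2 * 1) + y2 * (y2 * 1)) * (r * (r * (r * (r * 1)))))%R with
    ((x2 * x2 + y2 * y2) * (r * r * r * r) * ((s * s + c * c) * (s * s + c * c)))%R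
    by (rewrite hsc; ring).
  match goal with |- ?l = (?u + ?v * ?k)%R =>
    replace k with ((s * s + c * c) * k)%R by (rewrite hsc; ring) end.
  ring. }
assert (hI1 : is_RInt (fun t => (S + 2 * r ^ 3 * (a * cos t + b * sin t))%R) 0 (2 * PI) (2 * PI * S)%R).
{ assert (J := is_RInt_derive (V := R_CompleteNormedModule)
    (fun t => S * t + 2 * r ^ 3 * (a * sin t - b * cos t))%R
    (fun t => S + 2 * r ^ 3 * (a * cos t + b * sin t))%R 0 (2 * PI)).
  replace (2 * PI * S)%R with
    (minus (S * (2 * PI) + 2 * r ^ 3 * (a * sin (2 * PI) - b * cos (2 * PI)))
           (S * 0 + 2 * r ^ 3 * (a * sin 0 - b * cos 0)))%R.
  - apply J.
    + intros t _. auto_derive; trivial. ring.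
    + intros t _. apply (ex_derive_continuous (K := R_AbsRing) (V := R_NormedModule)).
      auto_derive; trivial.
  - rewrite cos_2PI, sin_2PI, cos_0, sin_0. unfold minus, plus, opp; simpl. ring. }
assert (hI2 := is_RInt_plus (V := R_NormedModule) _ _ _ _ _ _ hI1
  (is_RInt_scal (V := R_NormedModule) _ _ _ 2%R _ (kernel_orthogonal r hr))).
assert (hI3 := is_RInt_const (V := R_NormedModule) 0 (2 * PI) 1%R).
assert (hle := is_RInt_le _ _ _ _ _ _ (ltac:(lra) : (0 <= 2 * PI)%R) hI2 hI3).
unfold plus, scal, mult in hle; simpl in hle. unfold mult in hle; simpl in hle.
enough (2 * PI * S + 2 * 0 <= (2 * PI - 0) * 1)%R by nra.
apply hle. intros t _.
change (S + 2 * r ^ 3 * (a * cos t + b * sin t) +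
  2 * Re (E (polar r t) * K r (polar r t)) <= 1)%R.
rewrite <- hP, kernel_conj by lra.
assert (hw := w_disk (polar r t)). unfold in_disk in hw. rewrite Cmod_polar in hw by lra.
specialize (hw (proj2 hr)).
assert (hw2 : (Cmod (w (polar r t)) ^ 2 <= 1)%R).
{ generalize (Cmod_ge_0 (w (polar r t))). simpl. nra. }
replace (w (polar r t)) with (E (polar r t) + P (polar r t)) in hw2 by (unfold E; ring).
rewrite Cmod2_alt in hw2. rewrite Cmod2_alt.
destruct (E (polar r t)) as [e1 e2], (P (polar r t)) as [p1 p2].
unfold Re, Im, Cmult, Cplus, Cconj in *; simpl in *. nra.
Qed.

Lemma bessel_coefficients : (Cmod c1 ^ 2 + Cmod c2 ^ 2 <= 1)%R.
Proof.
destruct (Rle_dec (Cmod c1 ^ 2 + Cmod c2 ^ 2) 1) as [h|h]; [exact h|].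
apply Rnot_le_lt in h. exfalso.
assert (h1 : (0 <= Cmod c1 ^ 2)%R) by apply pow2_ge_0.
assert (h2 : (0 <= Cmod c2 ^ 2)%R) by apply pow2_ge_0.
set (x := (Cmod c1 ^ 2)%R) in *. set (y := (Cmod c2 ^ 2)%R) in *.
set (m := (x + y)%R) in *.
(* With (1 - d)^4 >= 1 - 4 d, this choice yields m (1 - 4 d) = (m + 1) / 2 > 1, against the bound on
   the circle of radius 1 - d. *)
set (d := ((m - 1) / (8 * m))%R).
assert (hd : (d * (8 * m) = m - 1)%R) by (unfold d; field; lra).
assert (hd0 : (0 < d)%R) by (apply Rdiv_lt_0_compat; lra).
assert (hd1 : (d < 1 / 8)%R) by (apply (Rmult_lt_reg_r (8 * m)); lra).
assert (H := bessel_circle (1 - d) (ltac:(lra))).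
fold x y in H.
assert (q : (1 - 2 * d <= (1 - d) ^ 2)%R) by nra.
assert (q4 : (1 - 4 * d <= (1 - d) ^ 4)%R).
{ replace ((1 - d) ^ 4)%R with (((1 - d) ^ 2) * ((1 - d) ^ 2))%R by ring. nra. }
assert (x * (1 - 4 * d) <= x * (1 - d) ^ 2)%R by (apply Rmult_le_compat_l; lra).
assert (y * (1 - 4 * d) <= y * (1 - d) ^ 4)%R by (apply Rmult_le_compat_l; lra).
assert (m * (1 - 4 * d) <= 1)%R by (unfold m; lra).
lra.
Qed.

End Bessel.

(** * Complex power series *)

Definition is_Cseries (x : nat -> C) (l : C) : Prop :=
  @is_series C_AbsRing C_NormedModule x l.

Lemma sum_n_Re (x : nat -> C) n :
  Re (@sum_n C_NormedModule x n) = sum_n (fun k => Re (x k)) n.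
Proof.
induction n as [|n IH]; [now rewrite !sum_O|].
rewrite !sum_Sn, <- IH. reflexivity.
Qed.

Lemma sum_n_Im (x : nat -> C) n :
  Im (@sum_n C_NormedModule x n) = sum_n (fun k => Im (x k)) n.
Proof.
induction n as [|n IH]; [now rewrite !sum_O|].
rewrite !sum_Sn, <- IH. reflexivity.
Qed.

Lemma is_Cseries_Re_Im x l : is_Cseries x l <->
  is_series (fun n => Re (x n)) (Re l) /\ is_series (fun n => Im (x n)) (Im l).
Proof.
split.
- intros h. split.
  + apply (filterlim_ext (fun n => Re (@sum_n C_NormedModule x n))).
    { intros n. apply sum_n_Re. }
    apply (filterlim_comp _ _ _ _ _ _ (locally (l : C_UniformSpace)) _ h).
    destruct l as [l1 l2]. apply (continuous_fst (U := R_UniformSpace) (V := R_UniformSpace)).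
  + apply (filterlim_ext (fun n => Im (@sum_n C_NormedModule x n))).
    { intros n. apply sum_n_Im. }
    apply (filterlim_comp _ _ _ _ _ _ (locally (l : C_UniformSpace)) _ h).
    destruct l as [l1 l2]. apply (continuous_snd (U := R_UniformSpace) (V := R_UniformSpace)).
- intros [h1 h2] Q [e He].
  assert (k1 := h1 _ (locally_ball (Re l) e)).
  assert (k2 := h2 _ (locally_ball (Im l) e)).
  unfold filtermap in *.
  generalize (filter_and _ _ k1 k2). apply filter_imp. intros n [b1 b2].
  apply He. rewrite <- sum_n_Re in b1. rewrite <- sum_n_Im in b2. split; assumption.
Qed.

Lemma is_Cseries_unique x l l' : is_Cseries x l -> is_Cseries x l' -> l = l'.
Proof.
rewrite !is_Cseries_Re_Im. intros [h1 h2] [h3 h4].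
apply is_series_unique in h1, h2, h3, h4.
destruct l, l'; simpl in *. congruence.
Qed.

Lemma is_Cseries_ext x y l : (forall n, x n = y n) -> is_Cseries x l -> is_Cseries y l.
Proof. apply is_series_ext. Qed.

Lemma is_Cseries_value x l l' : is_Cseries x l -> l = l' -> is_Cseries x l'.
Proof. intros h <-; exact h. Qed.

Lemma is_Cseries_minus x y l m : is_Cseries x l -> is_Cseries y m ->
  is_Cseries (fun n => x n - y n) (l - m).
Proof. exact (is_series_minus (V := C_NormedModule) x y l m). Qed.

Lemma is_Cseries_scal c x l : is_Cseries x l -> is_Cseries (fun n => c * x n) (c * l).
Proof. exact (is_series_scal (V := C_NormedModule) c x l). Qed.

Lemma is_Cseries_incr x l : is_Cseries x l -> is_Cseries (fun n => x (S n)) (l - x 0%nat).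
Proof.
intros h. apply (is_series_incr_1 (V := C_NormedModule)).
eapply is_Cseries_value; [exact h|]. unfold plus; simpl. ring.
Qed.

Lemma is_Cseries_decr x l : is_Cseries (fun n => x (S n)) (l - x 0%nat) -> is_Cseries x l.
Proof. exact (is_series_decr_1 (V := C_NormedModule) x l). Qed.

Lemma is_Cseries_norm x l b B : is_Cseries x l -> is_series b B ->
  (forall n, (Cmod (x n) <= b n)%R) -> (Cmod l <= B)%R.
Proof.
intros h hb hxb.
assert (hn : forall n, (Cmod (@sum_n C_NormedModule x n) <= sum_n b n)%R).
{ intros n. induction n as [|n IH]; [rewrite !sum_O; apply hxb|].
  rewrite !sum_Sn. eapply Rle_trans; [apply Cmod_triangle|].
  apply Rplus_le_compat; [exact IH | apply hxb]. }
assert (hlim : is_lim_seq (fun n => Cmod (@sum_n C_NormedModule x n)) (Cmod l)).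
{ apply (filterlim_comp _ _ _ _ _ _ _ _ h).
  intros Q [e He].
  apply locally_C.
  exists e. intros y hy. apply He.
  change (Rabs (Cmod y - Cmod l) < e)%R.
  eapply Rle_lt_trans; [|exact hy].
  apply (norm_triangle_inv (V := C_NormedModule)). }
exact (is_lim_seq_le _ _ (Cmod l) B hn hlim hb).
Qed.

Lemma ex_Cseries_abs (x : nat -> C) : ex_series (fun n => Cmod (x n)) -> exists l, is_Cseries x l.
Proof.
intros h.
assert (h1 : ex_series (fun n => Re (x n))).
{ apply (ex_series_le (V := R_CompleteNormedModule) _ _ (fun n => re_le_Cmod (x n)) h). }
assert (h2 : ex_series (fun n => Im (x n))).
{ apply (ex_series_le (V := R_CompleteNormedModule) _ _ (fun n => im_le_Cmod (x n)) h). }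
destruct h1 as [l1 h1], h2 as [l2 h2]. exists (l1, l2). apply is_Cseries_Re_Im. split; assumption.
Qed.

(** Reduced to the real Cauchy product, applied to the four products of real and imaginary parts. *)
Lemma is_Cseries_cauchy x y l m : is_Cseries x l -> is_Cseries y m ->
  ex_series (fun n => Cmod (x n)) -> ex_series (fun n => Cmod (y n)) ->
  is_Cseries (fun n => @sum_n C_NormedModule (fun k => x k * y (n - k)%nat) n) (l * m).
Proof.
rewrite !is_Cseries_Re_Im. intros [x1 x2] [y1 y2] hx hy.
assert (ax1 : ex_series (fun n => Rabs (Re (x n)))).
{ apply (ex_series_le (V := R_CompleteNormedModule) _ (fun n => Cmod (x n))); [|exact hx].
  intros n. change (Rabs (Rabs (Re (x n))) <= Cmod (x n))%R. rewrite Rabs_Rabsolu. apply re_le_Cmod. }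
assert (ax2 : ex_series (fun n => Rabs (Im (x n)))).
{ apply (ex_series_le (V := R_CompleteNormedModule) _ (fun n => Cmod (x n))); [|exact hx].
  intros n. change (Rabs (Rabs (Im (x n))) <= Cmod (x n))%R. rewrite Rabs_Rabsolu. apply im_le_Cmod. }
assert (ay1 : ex_series (fun n => Rabs (Re (y n)))).
{ apply (ex_series_le (V := R_CompleteNormedModule) _ (fun n => Cmod (y n))); [|exact hy].
  intros n. change (Rabs (Rabs (Re (y n))) <= Cmod (y n))%R. rewrite Rabs_Rabsolu. apply re_le_Cmod. }
assert (ay2 : ex_series (fun n => Rabs (Im (y n)))).
{ apply (ex_series_le (V := R_CompleteNormedModule) _ (fun n => Cmod (y n))); [|exact hy].
  intros n. change (Rabs (Rabs (Im (y n))) <= Cmod (y n))%R. rewrite Rabs_Rabsolu. apply im_le_Cmod. }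
split.
- assert (h := is_series_minus _ _ _ _ (is_series_mult _ _ _ _ x1 y1 ax1 ay1)
    (is_series_mult _ _ _ _ x2 y2 ax2 ay2)).
  rewrite re_mult. eapply is_series_ext; [|exact h].
  intros n. rewrite sum_n_Re, sum_n_Reals.
  transitivity (sum_f_R0 (fun k => Re (x k) * Re (y (n - k)%nat))%R n -
    sum_f_R0 (fun k => Im (x k) * Im (y (n - k)%nat))%R n)%R; [reflexivity|].
  rewrite <- minus_sum. apply sum_eq. intros k _. rewrite re_mult. reflexivity.
- assert (h := is_series_plus _ _ _ _ (is_series_mult _ _ _ _ x1 y2 ax1 ay2)
    (is_series_mult _ _ _ _ x2 y1 ax2 ay1)).
  rewrite im_mult. eapply is_series_ext; [|exact h].
  intros n. rewrite sum_n_Im, sum_n_Reals.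
  transitivity (sum_f_R0 (fun k => Re (x k) * Im (y (n - k)%nat))%R n +
    sum_f_R0 (fun k => Im (x k) * Re (y (n - k)%nat))%R n)%R; [reflexivity|].
  rewrite <- plus_sum. apply sum_eq. intros k _. rewrite im_mult. reflexivity.
Qed.

(** Radius of convergence at least 1, expressed through the moduli so that the real theory of
    [CV_radius] applies. *)
Definition disk_summable (a : nat -> C) : Prop :=
  forall s : R, (0 <= s < 1)%R -> ex_series (fun n => Cmod (a n) * s ^ n)%R.

Definition Cpsum (a : nat -> C) (z : C) : C :=
  (Series (fun n => Re (a n * z ^ n)), Series (fun n => Im (a n * z ^ n))).

Lemma disk_summable_abs a z : disk_summable a -> in_disk z ->
  ex_series (fun n => Cmod (a n * z ^ n)).
Proof.
intros ha hz. eapply ex_series_ext; [|apply (ha (Cmod z))].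
- intros n. simpl. rewrite Cmod_mult, Cmod_pow. reflexivity.
- split; [apply Cmod_ge_0 | exact hz].
Qed.

Lemma Cpsum_unique a z l : is_Cseries (fun n => a n * z ^ n) l -> Cpsum a z = l.
Proof.
intros h. apply is_Cseries_Re_Im in h. destruct h as [h1 h2].
unfold Cpsum. rewrite (is_series_unique _ _ h1), (is_series_unique _ _ h2).
destruct l; reflexivity.
Qed.

Lemma Cpsum_correct a z : disk_summable a -> in_disk z ->
  is_Cseries (fun n => a n * z ^ n) (Cpsum a z).
Proof.
intros ha hz. destruct (ex_Cseries_abs _ (disk_summable_abs a z ha hz)) as [l hl].
rewrite (Cpsum_unique a z l hl). exact hl.
Qed.

Lemma pow_n_Cpow (z : C) n : pow_n (K := C_Ring) z n = z ^ n.
Proof.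
induction n as [|n IH]; [reflexivity|]. rewrite Cpow_S, <- IH. reflexivity.
Qed.

Lemma is_pseries_Cseries a z l :
  @is_pseries C_AbsRing C_NormedModule a z l <-> is_Cseries (fun n => a n * z ^ n) l.
Proof.
assert (E : forall n, scal (pow_n z n) (a n) = a n * z ^ n).
{ intros n. rewrite (Cmult_comm (a n)), <- pow_n_Cpow. reflexivity. }
split; apply is_series_ext; intros n; [|symmetry]; apply E.
Qed.

Lemma disk_summable_bounded a (M : R) : (forall n, (Cmod (a n) <= M)%R) -> disk_summable a.
Proof.
intros hM s hs.
apply (ex_series_le (V := R_CompleteNormedModule) _ (fun n => M * s ^ n)%R).
- intros n. change (Rabs (Cmod (a n) * s ^ n) <= M * s ^ n)%R.
  assert (hp : (0 <= s ^ n)%R) by (apply pow_le; lra).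
  rewrite Rabs_pos_eq; [|apply Rmult_le_pos; [apply Cmod_ge_0 | exact hp]].
  apply Rmult_le_compat_r; [exact hp | apply hM].
- apply (ex_series_scal (V := R_NormedModule)). apply ex_series_geom. rewrite Rabs_pos_eq; lra.
Qed.

Lemma CV_radius_ge_1 (b : nat -> R) :
  (forall s : R, (0 <= s < 1)%R -> ex_series (fun n => b n * s ^ n)%R) ->
  forall s : R, (0 <= s < 1)%R -> Rbar_lt (Rabs s) (CV_radius b).
Proof.
intros hb s hs. rewrite Rabs_pos_eq by lra.
(* Convergence at the midpoint of s and 1 gives the strict inequality at s. *)
apply Rbar_lt_le_trans with ((1 + s) / 2)%R; [simpl; lra|].
apply Rbar_not_lt_le. intros h.
apply (CV_disk_outside b ((1 + s) / 2)%R).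
- rewrite Rabs_pos_eq by lra. exact h.
- apply ex_series_lim_0, hb. lra.
Qed.

(** [is_pseries] gives mere convergence. Restricted to real points it becomes two real power series,
    whose radii are then at least 1, and inside the radius convergence is absolute. *)
Lemma disk_summable_of_pseries a f :
  (forall z, in_disk z -> @is_pseries C_AbsRing C_NormedModule a z (f z)) -> disk_summable a.
Proof.
intros H.
assert (K : forall s : R, (0 <= s < 1)%R ->
  ex_series (fun n => Re (a n) * s ^ n)%R /\ ex_series (fun n => Im (a n) * s ^ n)%R).
{ intros s hs. assert (hd : in_disk s) by (unfold in_disk; rewrite Cmod_R, Rabs_pos_eq; lra).
  assert (h := H s hd). apply is_pseries_Cseries, is_Cseries_Re_Im in h.
  destruct h as [h1 h2]. split; eexists.
  - eapply is_series_ext; [|exact h1]. intros n. cbv beta. rewrite <- RtoC_pow, re_scal_r. reflexivity.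
  - eapply is_series_ext; [|exact h2]. intros n. cbv beta. rewrite <- RtoC_pow, im_scal_r. reflexivity. }
intros s hs.
assert (h1 := CV_disk_inside _ _ (CV_radius_ge_1 _ (fun s hs => proj1 (K s hs)) s hs)).
assert (h2 := CV_disk_inside _ _ (CV_radius_ge_1 _ (fun s hs => proj2 (K s hs)) s hs)).
eapply (ex_series_le (V := R_CompleteNormedModule)); [|exact (ex_series_plus _ _ h1 h2)].
intros n. change (Rabs (Cmod (a n) * s ^ n) <= Rabs (Re (a n) * s ^ n) + Rabs (Im (a n) * s ^ n))%R.
assert (hp : (0 <= s ^ n)%R) by (apply pow_le; lra).
rewrite !Rabs_mult, (Rabs_pos_eq (s ^ n)), (Rabs_pos_eq (Cmod _)) by (assumption || apply Cmod_ge_0).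
rewrite <- Rmult_plus_distr_r. apply Rmult_le_compat_r; [exact hp | apply Cmod_le_Re_Im].
Qed.

Definition Cps_derive (a : nat -> C) (n : nat) : C := INR (S n) * a (S n).

Lemma disk_summable_derive a : disk_summable a -> disk_summable (Cps_derive a).
Proof.
intros ha s hs.
assert (h := CV_radius_ge_1 _ ha s hs).
rewrite <- CV_radius_derive in h. apply CV_disk_inside in h.
eapply ex_series_ext; [|exact h].
intros n. unfold PS_derive, Cps_derive.
rewrite Cmod_mult, Cmod_R, (Rabs_pos_eq (INR (S n))) by apply pos_INR.
rewrite Rabs_pos_eq; [reflexivity|].
apply Rmult_le_pos; [apply Rmult_le_pos; [apply pos_INR | apply Cmod_ge_0] | apply pow_le; lra].
Qed.

(** Domination by the derived series, whose terms carry the extra factor n + 1 >= 1; this avoids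
    dividing by s, which may be 0. *)
Lemma disk_summable_incr a : disk_summable a -> disk_summable (fun n => a (S n)).
Proof.
intros ha s hs.
apply (ex_series_le (V := R_CompleteNormedModule) _ _) with (2 := disk_summable_derive a ha s hs).
intros n. change (Rabs (Cmod (a (S n)) * s ^ n) <= Cmod (Cps_derive a n) * s ^ n)%R.
assert (hp : (0 <= s ^ n)%R) by (apply pow_le; lra).
assert (hm := Cmod_ge_0 (a (S n))).
rewrite Rabs_pos_eq by (apply Rmult_le_pos; assumption).
apply Rmult_le_compat_r; [exact hp|].
unfold Cps_derive. rewrite Cmod_mult, Cmod_R, Rabs_pos_eq by apply pos_INR.
rewrite S_INR. generalize (pos_INR n). nra.
Qed.

(** Induction on T (n+1) = y T n + (n+1) (y - z)^2 z^n. The constant is twice the optimal one, but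
    it is exactly the factor in the twice derived series. *)
Lemma Cpow_taylor_bound (y z : C) (s : R) n : (Cmod y <= s)%R -> (Cmod z <= s)%R ->
  (Cmod (y ^ S (S n) - z ^ S (S n) - INR (S (S n)) * (y - z) * z ^ S n) <=
   INR (S (S n)) * INR (S n) * s ^ n * (Cmod (y - z) * Cmod (y - z)))%R.
Proof.
intros hy hz.
set (T := fun n => y ^ S n - z ^ S n - INR (S n) * (y - z) * z ^ n).
assert (hT : forall n, T (S n) = y * T n + INR (S n) * (y - z) * (y - z) * z ^ n).
{ intros k. unfold T. rewrite !Cpow_S, (S_INR (S k)), RtoC_plus. ring. }
assert (hs : (0 <= s)%R) by (eapply Rle_trans; [apply Cmod_ge_0 | exact hy]).
set (d := Cmod (y - z)).
assert (hd : (0 <= d)%R) by apply Cmod_ge_0.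
assert (hzn : forall k, (Cmod (z ^ k) <= s ^ k)%R).
{ intros k. rewrite Cmod_pow. apply pow_incr. split; [apply Cmod_ge_0 | exact hz]. }
change (Cmod (T (S n)) <= INR (S (S n)) * INR (S n) * s ^ n * (d * d))%R.
induction n as [|n IH].
- rewrite hT. replace (T 0%nat) with (RtoC 0) by (unfold T; simpl; ring).
  replace (y * 0 + INR 1 * (y - z) * (y - z) * z ^ 0) with ((y - z) * (y - z)) by (simpl; ring).
  rewrite Cmod_mult. fold d. simpl. nra.
- rewrite hT. eapply Rle_trans; [apply Cmod_triangle|].
  rewrite !Cmod_mult, Cmod_R, Rabs_pos_eq by apply pos_INR. fold d.
  assert (hn := pos_INR n). assert (hsn := pow_le s n hs).
  assert (h1 : (Cmod y * Cmod (T (S n)) <= s * (INR (S (S n)) * INR (S n) * s ^ n * (d * d)))%R).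
  { apply Rmult_le_compat; try assumption; apply Cmod_ge_0. }
  assert (h2 : (INR (S (S n)) * d * d * Cmod (z ^ S n) <= INR (S (S n)) * d * d * s ^ S n)%R).
  { apply Rmult_le_compat_l; [|apply hzn]. apply Rmult_le_pos; [apply Rmult_le_pos|]; try assumption. apply pos_INR. }
  eapply Rle_trans; [apply Rplus_le_compat; [exact h1 | exact h2]|].
  rewrite (S_INR (S (S n))), (S_INR (S n)), (S_INR n). simpl pow.
  assert (0 <= s * s ^ n * (d * d))%R by (repeat apply Rmult_le_pos; assumption).
  nra.
Qed.

(** Termwise, the first-order Taylor errors add up to at most M |y - z|^2, where M is the sum at
    radius [s] of the moduli of the twice derived series. *)
Lemma Cpsum_derive a z : disk_summable a -> in_disk z ->
  Cderiv (Cpsum a) z (Cpsum (Cps_derive a) z).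
Proof.
intros ha hz. assert (hm := Cmod_ge_0 z). unfold in_disk in hz.
set (s := ((1 + Cmod z) / 2)%R).
assert (hs : (0 <= s < 1)%R) by (unfold s; lra).
assert (hda := disk_summable_derive a ha).
destruct (disk_summable_derive _ hda s hs) as [M hM].
assert (hM0 : (0 <= M)%R).
{ eapply Rle_trans; [apply Cmod_ge_0|].
  refine (is_Cseries_norm _ _ _ _
    (Cpsum_correct _ s (disk_summable_derive _ hda) _) hM _).
  - unfold in_disk. rewrite Cmod_R, Rabs_pos_eq; lra.
  - intros n. rewrite Cmod_mult, Cmod_pow, Cmod_R, Rabs_pos_eq by lra. apply Rle_refl. }
apply Cderiv_eps. intros eps he.
exists (Rmin ((1 - Cmod z) / 2) (eps / (M + 1))). split.
{ apply Rmin_glb_lt; [lra | apply Rdiv_lt_0_compat; lra]. }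
intros y hy.
assert (hy1 := Rlt_le_trans _ _ _ hy (Rmin_l _ _)).
assert (hy2 := Rlt_le_trans _ _ _ hy (Rmin_r _ _)).
assert (hys : (Cmod y <= s)%R).
{ replace y with ((y - z) + z) by ring.
  eapply Rle_trans; [apply Cmod_triangle|]. unfold s. lra. }
set (d := Cmod (y - z)) in *.
assert (hd : (0 <= d)%R) by apply Cmod_ge_0.
assert (Sy := Cpsum_correct a y ha (ltac:(unfold in_disk; lra) : in_disk y)).
assert (Sz := Cpsum_correct a z ha hz).
assert (Sd := is_Cseries_scal (y - z) _ _ (Cpsum_correct _ z hda hz)).
(* The two index shifts, here and in the next line, discard terms of value 0: a0 - a0, then a1 (y -
   z) - (y - z) a1. *)
assert (S1 := is_Cseries_minus _ _ _ _ (is_Cseries_incr _ _ (is_Cseries_minus _ _ _ _ Sy Sz)) Sd).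
apply is_Cseries_incr in S1.
apply Rle_trans with (M * (d * d))%R.
- refine (is_Cseries_norm _ _ _ _ (is_Cseries_value _ _ _ S1 _) (is_series_scal_r (d * d) _ _ hM) _).
  + unfold Cps_derive. simpl. ring.
  + intros n. simpl (_ - _)%nat.
    replace (a (S (S n)) * y ^ S (S n) - a (S (S n)) * z ^ S (S n) -
      (y - z) * (Cps_derive a (S n) * z ^ S n)) with
      (a (S (S n)) * (y ^ S (S n) - z ^ S (S n) - INR (S (S n)) * (y - z) * z ^ S n))
      by (unfold Cps_derive; ring).
    unfold Cps_derive. rewrite !Cmod_mult, !Cmod_R, !Rabs_pos_eq by apply pos_INR.
    assert (hb := Cpow_taylor_bound y z s n hys (ltac:(unfold s; lra))).
    fold d in hb.
    eapply Rle_trans; [apply Rmult_le_compat_l; [apply Cmod_ge_0 | exact hb]|].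
    right. ring.
- assert (h : (eps / (M + 1) * (M + 1) = eps)%R) by (field; lra).
  assert (d * (M + 1) <= eps)%R by (rewrite <- h; apply Rmult_le_compat_r; lra).
  nra.
Qed.

Lemma Cpsum_0 a : Cpsum a 0 = a 0%nat.
Proof.
apply Cpsum_unique, is_pseries_Cseries. exact (is_pseries_0 (V := C_NormedModule) a).
Qed.

(** * The principal logarithm and phi_B *)

(** On the positive real axis the argument of [acos] is 1, where [acos] is not differentiable; the
    [atan] form is smooth on the whole right half-plane. *)
Lemma Carg_atan (z : C) : (0 < Re z)%R -> Carg z = atan (Im z / Re z).
Proof.
intros hx. destruct z as [x y]. unfold Carg. simpl in *.
assert (hm : (0 < Cmod (x, y))%R) by (apply Cmod_gt_0; intros h; injection h; lra).
assert (hm2 : (Cmod (x, y) * Cmod (x, y) = x * x + y * y)%R).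
{ generalize (Cmod2_alt (x, y)). simpl. nra. }
set (m := Cmod (x, y)) in *.
assert (hc : (0 < x / m)%R) by (apply Rdiv_lt_0_compat; assumption).
assert (E : acos (x / m) = atan (Rabs y / x)).
{ rewrite acos_atan by exact hc. f_equal.
  replace (1 - (x / m)²)%R with ((y / m)²)%R.
  - rewrite sqrt_Rsqr_abs. unfold Rdiv at 2. rewrite Rabs_mult, Rabs_inv, (Rabs_pos_eq m) by lra.
    field. split; lra.
  - unfold Rsqr. apply (Rmult_eq_reg_r (m * m)); [|nra]. field_simplify; [|lra|lra]. nra. }
rewrite E. destruct (Rle_dec 0 y) as [h|h].
- rewrite Rabs_pos_eq by exact h. reflexivity.
- rewrite Rabs_left, <- atan_opp by lra. f_equal. field. lra.
Qed.

(* Apply the real mean value theorem on the segment from z to y to both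
   components. *)
Lemma Cderiv_of_segments (F D : C -> C) (z : C) (r : R) : (0 < r)%R ->
  Ccontinuous D z ->
  (forall (d : C) (t : R), (Cmod (t * d) < r)%R ->
    is_derive (fun s : R => Re (F (z + s * d))) t (Re (d * D (z + t * d))) /\
    is_derive (fun s : R => Im (F (z + s * d))) t (Im (d * D (z + t * d)))) ->
  Cderiv F z (D z).
Proof.
intros hr hD H. apply Cderiv_eps. intros eps he.
assert (K : exists del : R, (0 < del)%R /\
  forall y, (Cmod (y - z) < del)%R -> (Cmod (D y - D z) <= eps / 2)%R).
{ assert (hb : locally (D z : C_UniformSpace) (fun y => (Cmod (y - D z) < eps / 2)%R)).
  { apply locally_C. exists (mkposreal (eps / 2) ltac:(lra)). intros y hy. exact hy. }
  assert (h := hD _ hb). apply locally_C in h. destruct h as [d hd].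
  exists d. split; [apply cond_pos|]. intros y hy. left. exact (hd y hy). }
destruct K as [d0 [hd0 Hd0]].
exists (Rmin r d0). split; [apply Rmin_glb_lt; assumption|].
intros y hy.
assert (hy1 := Rlt_le_trans _ _ _ hy (Rmin_l _ _)).
assert (hy2 := Rlt_le_trans _ _ _ hy (Rmin_r _ _)).
set (d := y - z) in *.
assert (hd : (0 <= Cmod d)%R) by apply Cmod_ge_0.
assert (hts : forall t : R, (0 <= t <= 1)%R -> (Cmod (t * d) <= Cmod d)%R).
{ intros t ht. rewrite Cmod_mult, Cmod_R, Rabs_pos_eq by lra. nra. }
assert (hclose : forall t : R, (0 <= t <= 1)%R ->
  (Cmod (d * D (z + t * d) - d * D z)%C <= Cmod d * (eps / 2))%R).
{ intros t ht. replace (d * D (z + t * d) - d * D z) with (d * (D (z + t * d) - D z)) by ring.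
  rewrite Cmod_mult. apply Rmult_le_compat_l; [exact hd|]. apply Hd0.
  replace (z + t * d - z) with (t * d) by ring.
  eapply Rle_lt_trans; [apply hts; exact ht | exact hy2]. }
assert (hin : forall t : R, (0 <= t <= 1)%R -> (Cmod (t * d) < r)%R).
{ intros t ht. eapply Rle_lt_trans; [apply hts; exact ht | exact hy1]. }
assert (E0 : z + 0%R * d = z) by ring.
assert (E1 : z + 1%R * d = y) by (unfold d; ring).
assert (hRe : (Rabs (Re (F y - F z - d * D z)%C) <= Cmod d * (eps / 2))%R).
{ destruct (MVT_gen (fun s : R => Re (F (z + s * d))) 0 1
    (fun t => Re (d * D (z + t * d)))) as [c [hc Ec]].
  - intros t ht. rewrite Rmin_left, Rmax_right in ht by lra.
    apply H, hin. lra.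
  - intros t ht. rewrite Rmin_left, Rmax_right in ht by lra.
    apply derivable_continuous_pt. eexists. apply is_derive_Reals.
    exact (proj1 (H d t (hin t ht))).
  - rewrite Rmin_left, Rmax_right in hc by lra. rewrite E0, E1 in Ec.
    eapply Rle_trans; [|apply (hclose c hc)].
    eapply Rle_trans; [|apply re_le_Cmod]. right. f_equal.
    unfold Cminus. rewrite !re_plus, !re_opp. lra. }
assert (hIm : (Rabs (Im (F y - F z - d * D z)%C) <= Cmod d * (eps / 2))%R).
{ destruct (MVT_gen (fun s : R => Im (F (z + s * d))) 0 1
    (fun t => Im (d * D (z + t * d)))) as [c [hc Ec]].
  - intros t ht. rewrite Rmin_left, Rmax_right in ht by lra.
    apply H, hin. lra.
  - intros t ht. rewrite Rmin_left, Rmax_right in ht by lra.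
    apply derivable_continuous_pt. eexists. apply is_derive_Reals.
    exact (proj2 (H d t (hin t ht))).
  - rewrite Rmin_left, Rmax_right in hc by lra. rewrite E0, E1 in Ec.
    eapply Rle_trans; [|apply (hclose c hc)].
    eapply Rle_trans; [|apply im_le_Cmod]. right. f_equal.
    unfold Cminus. rewrite !im_plus, !im_opp. lra. }
eapply Rle_trans; [apply Cmod_le_Re_Im|]. lra.
Qed.

Lemma ln_Cmod (x y : R) : (0 < x * x + y * y)%R -> ln (Cmod (x, y)) = (ln (x * x + y * y) / 2)%R.
Proof.
intros h. unfold Cmod; simpl.
replace (x * (x * 1) + y * (y * 1))%R with (x * x + y * y)%R by ring.
rewrite <- (sqrt_sqrt (x * x + y * y)) at 2 by lra.
rewrite ln_mult by (apply sqrt_lt_R0; exact h). field.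
Qed.

(** Within distance [Re z] of z the real part stays positive, so on such segments ln (x^2 + y^2) / 2
    and atan (y / x) can be differentiated as real functions. *)
Lemma Clog_derive z : (0 < Re z)%R -> Cderiv Clog z (/ z).
Proof.
intros hz.
assert (hz0 : z <> 0) by (intros ->; simpl in hz; lra).
apply (Cderiv_of_segments Clog (fun y => / y) z (Re z) hz).
{ eapply Cderiv_continuous, Cderiv_inv; exact hz0. }
intros d t ht.
assert (hpos : forall s : R, (Cmod (s * d) < Re z)%R -> (0 < Re (z + s * d))%R).
{ intros s hs. rewrite re_plus. assert (h := re_le_Cmod (s * d)).
  generalize (Rle_abs (- Re (s * d))). rewrite Rabs_Ropp. lra. }
assert (hp := hpos t ht).
assert (hloc : locally t (fun s : R => (Cmod (s * d) < Re z)%R)).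
{ assert (hd := Cmod_ge_0 d).
  assert (he : (0 < (Re z - Cmod (t * d)) / (Cmod d + 1))%R) by (apply Rdiv_lt_0_compat; lra).
  exists (mkposreal _ he). intros s hs. change (Rabs (s - t) < (Re z - Cmod (t * d)) / (Cmod d + 1))%R in hs.
  apply (Rmult_lt_compat_r (Cmod d + 1)) in hs; [|lra].
  unfold Rdiv in hs. rewrite Rmult_assoc, Rinv_l, Rmult_1_r in hs by lra.
  replace (s * d) with ((s - t)%R * d + t * d) by (rewrite RtoC_minus; ring).
  eapply Rle_lt_trans; [apply Cmod_triangle|]. rewrite (Cmod_mult (s - t)%R), Cmod_R.
  generalize (Rabs_pos (s - t)). nra. }
destruct z as [a b], d as [p q].
assert (Ep : forall s : R, (a, b) + s * (p, q) = (a + s * p, b + s * q)%R).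
{ intros s. unfold Cplus, Cmult, RtoC; simpl. f_equal; ring. }
rewrite Ep in hp. simpl in hp. rewrite Ep.
assert (sum_sqr_pos : forall u v : R, (0 < u)%R -> (0 < u * u + v * v)%R) by (intros; nra).
assert (hX := sum_sqr_pos _ (b + t * q)%R hp).
split.
- apply (is_derive_ext_loc (fun s => ln ((a + s * p) * (a + s * p) + (b + s * q) * (b + s * q)) / 2)%R).
  + eapply filter_imp; [|exact hloc]. intros s hs. apply hpos in hs.
    rewrite Ep in hs |- *. simpl in hs. symmetry. apply ln_Cmod, sum_sqr_pos, hs.
  + auto_derive; [exact hX|]. simpl. field. intros h0. simpl in h0. lra.
- apply (is_derive_ext_loc (fun s => atan ((b + s * q) / (a + s * p)))%R).
  + eapply filter_imp; [|exact hloc]. intros s hs. apply hpos in hs.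
    rewrite Ep in hs |- *. simpl in hs. symmetry. apply (Carg_atan (_, _)). exact hs.
  + auto_derive; [lra|]. simpl. field. repeat split; intros h0; simpl in h0; lra.
Qed.

Lemma Re_one_plus_pos w : in_disk w -> (0 < Re (1 + w))%R.
Proof.
unfold in_disk. intros hw. rewrite re_plus, re_RtoC.
generalize (re_le_Cmod w) (Rle_abs (- Re w)). rewrite Rabs_Ropp. lra.
Qed.

(** The real part is 1 - ln |1 + w|, which is positive because |1 + w| < 2 < e. *)
Lemma one_minus_Clog_neq_0 w : in_disk w -> 1 - Clog (1 + w) <> 0.
Proof.
intros hw h.
assert (h1 : (1 - ln (Cmod (1 + w)) = 0)%R) by (apply (f_equal Re) in h; exact h).
assert (hlt : (Cmod (1 + w) < exp 1)%R).
{ apply Rle_lt_trans with (1 + Cmod w)%R.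
  - eapply Rle_trans; [apply Cmod_triangle|]. rewrite Cmod_1. lra.
  - unfold in_disk in hw. generalize (exp_ineq1 1). lra. }
assert (hpos : (0 < Cmod (1 + w))%R).
{ apply Cmod_gt_0. intros h0. assert (hr := Re_one_plus_pos w hw). rewrite h0 in hr. simpl in hr. lra. }
assert (h2 := ln_increasing _ _ hpos hlt). rewrite ln_exp in h2. lra.
Qed.

Lemma phi_B_neq_0 w : in_disk w -> phi_B w <> 0.
Proof.
intros hw h. apply C1_nz. rewrite <- (Cmult_0_l (1 - Clog (1 + w))), <- h.
unfold phi_B. field. apply one_minus_Clog_neq_0; exact hw.
Qed.

(** In this form the derivative contains the logarithm only through [phi_B w] itself, so w' can
    later be expressed by the quotient and w. *)
Lemma phi_B_derive w : in_disk w -> Cderiv phi_B w (phi_B w * phi_B w / (1 + w)).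
Proof.
intros hw. assert (hr := Re_one_plus_pos w hw).
assert (h0 := one_minus_Clog_neq_0 w hw).
assert (h1 : 1 + w <> 0) by (intros h; rewrite h in hr; simpl in hr; lra).
eapply Cderiv_value.
- apply Cderiv_div; [apply Cderiv_const | | exact h0].
  apply Cderiv_minus; [apply Cderiv_const|].
  apply (Cderiv_comp Clog (fun y => 1 + y)).
  + apply Clog_derive; exact hr.
  + apply Cderiv_plus; [apply Cderiv_const | apply Cderiv_id].
- unfold phi_B. simpl. field. split; assumption.
Qed.

(** * The coefficient inequality *)

Lemma in_disk_0 : in_disk 0.
Proof. unfold in_disk. rewrite Cmod_0. lra. Qed.

(** Dividing f by z first leaves an expression without division by z, so one formula also covers the
    filled-in value at 0. *)
Lemma log_deriv_quotient_factored (f h : C -> C) (z dh : C) :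
  (forall y, in_disk y -> f y = y * h y) -> in_disk z -> h z <> 0 -> Cderiv h z dh ->
  log_deriv_quotient f z = 1 + z * dh / h z.
Proof.
intros hf hz hh hd. unfold log_deriv_quotient.
destruct (Ceq_dec z 0) as [->|hz0].
{ unfold Cdiv. ring. }
assert (E : Cderiv f z (h z + z * dh)).
{ apply (Cderiv_disk_ext (fun y => y * h y)); [exact hz | intros y hy; symmetry; apply hf; exact hy|].
  eapply Cderiv_value; [apply Cderiv_mult; [apply Cderiv_id | exact hd]|]. simpl; ring. }
rewrite (is_C_derive_unique _ _ _ E), hf by exact hz. field. split; assumption.
Qed.

Section UpperBound.

Variables (f : C -> C) (a : nat -> C) (w : C -> C).
Hypothesis f_expansion : has_expansion f a.
Hypothesis f_neq_0 : forall z, in_disk z -> z <> 0 -> f z <> 0.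
Hypothesis w_analytic : analytic_in_disk w.
Hypothesis w_disk : forall z, in_disk z -> in_disk (w z).
Hypothesis w_0 : w 0 = 0.
Hypothesis f_w : forall z, in_disk z -> log_deriv_quotient f z = phi_B (w z).

(** Coefficients of h = f(z) / z, which has no zero in the disk. Three derivatives occur: [v]
    involves G', hence h'', and its own derivative involves h'''. *)
Let a1 (n : nat) : C := a (S n).
Let h : C -> C := Cpsum a1.
Let h1 : C -> C := Cpsum (Cps_derive a1).
Let h2 : C -> C := Cpsum (Cps_derive (Cps_derive a1)).
Let h3 : C -> C := Cpsum (Cps_derive (Cps_derive (Cps_derive a1))).

Lemma factor_summable : disk_summable a1.
Proof. apply disk_summable_incr, (disk_summable_of_pseries a f). apply f_expansion. Qed.

Lemma factor_derive z : in_disk z -> Cderiv h z (h1 z).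
Proof. apply Cpsum_derive, factor_summable. Qed.

Lemma factor_d1_derive z : in_disk z -> Cderiv h1 z (h2 z).
Proof. apply Cpsum_derive, disk_summable_derive, factor_summable. Qed.

Lemma factor_d2_derive z : in_disk z -> Cderiv h2 z (h3 z).
Proof. apply Cpsum_derive, disk_summable_derive, disk_summable_derive, factor_summable. Qed.

Lemma factor_at_0 : h 0 = 1.
Proof. unfold h. rewrite Cpsum_0. apply f_expansion. Qed.

Lemma factor_d1_at_0 : h1 0 = a 2%nat.
Proof. unfold h1. rewrite Cpsum_0. unfold Cps_derive, a1. simpl. ring. Qed.

Lemma factor_d2_at_0 : h2 0 = 2 * a 3%nat.
Proof.
unfold h2. rewrite Cpsum_0. unfold Cps_derive, a1. simpl.
rewrite RtoC_plus. ring.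
Qed.

Lemma factorization z : in_disk z -> f z = z * h z.
Proof.
intros hz. destruct f_expansion as [e0 [_ e]].
assert (S1 := proj1 (is_pseries_Cseries _ _ _) (e z hz)).
apply is_Cseries_incr in S1. rewrite e0 in S1.
assert (S2 := is_Cseries_scal z _ _ (Cpsum_correct a1 z factor_summable hz)).
replace (f z) with (f z - 0 * z ^ 0) by ring.
apply (is_Cseries_unique _ _ _ S1).
eapply is_Cseries_ext; [|exact S2]. intros n. unfold a1. rewrite Cpow_S. ring.
Qed.

Lemma factor_neq_0 z : in_disk z -> h z <> 0.
Proof.
intros hz. destruct (Ceq_dec z 0) as [->|hz0].
- rewrite factor_at_0. apply C1_nz.
- intros e. apply (f_neq_0 z hz hz0). rewrite factorization, e by exact hz. ring.
Qed.

Let G (z : C) : C := 1 + z * h1 z / h z.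
Let G1 (z : C) : C := (h1 z + z * h2 z) / h z - z * (h1 z * h1 z) / (h z * h z).

Lemma quotient_phi_B z : in_disk z -> G z = phi_B (w z).
Proof.
intros hz. rewrite <- f_w by exact hz. symmetry.
apply log_deriv_quotient_factored; [exact factorization | exact hz | apply factor_neq_0; exact hz | apply factor_derive; exact hz].
Qed.

Lemma quotient_derive z : in_disk z -> Cderiv G z (G1 z).
Proof.
intros hz. assert (hh := factor_neq_0 z hz). eapply Cderiv_value.
- apply Cderiv_plus; [apply Cderiv_const|].
  apply Cderiv_div; [|apply factor_derive; exact hz | exact hh].
  apply Cderiv_mult; [apply Cderiv_id | apply factor_d1_derive; exact hz].
- unfold G1. simpl. field. exact hh.
Qed.

(** The derivative has to exist throughout the disk, but its value matters only at 0; hence the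
    conditional formula. *)
Lemma quotient_d1_derive z : in_disk z -> exists l, Cderiv G1 z l /\
  (z = 0 -> l = 4 * a 3%nat - 2 * (a 2%nat * a 2%nat)).
Proof.
intros hz. assert (hh := factor_neq_0 z hz). eexists. split.
- unfold G1. apply Cderiv_minus; apply Cderiv_div.
  + apply Cderiv_plus; [apply factor_d1_derive; exact hz|].
    apply Cderiv_mult; [apply Cderiv_id | apply factor_d2_derive; exact hz].
  + apply factor_derive; exact hz.
  + exact hh.
  + apply Cderiv_mult; [apply Cderiv_id|].
    apply Cderiv_mult; apply factor_d1_derive; exact hz.
  + apply Cderiv_mult; apply factor_derive; exact hz.
  + apply Cmult_neq_0; exact hh.
- intros ->. rewrite factor_at_0, factor_d1_at_0, factor_d2_at_0. simpl. field.
Qed.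

Let v (z : C) : C := G1 z * (1 + w z) / (G z * G z).

Lemma schwarz_derive z : in_disk z -> Cderiv w z (v z).
Proof.
intros hz. destruct (w_analytic z hz : exists l : C, Cderiv w z l) as [l hl].
assert (hw := w_disk z hz).
assert (E : Cderiv G z (l * (phi_B (w z) * phi_B (w z) / (1 + w z)))).
{ apply (Cderiv_disk_ext (fun y => phi_B (w y))); [exact hz | intros y hy; symmetry; apply quotient_phi_B; exact hy|].
  apply Cderiv_comp; [apply phi_B_derive; exact hw | exact hl]. }
assert (h0 : 1 + w z <> 0).
{ intros e. assert (hr := Re_one_plus_pos _ hw). rewrite e in hr. simpl in hr. lra. }
eapply Cderiv_value; [exact hl|].
unfold v. rewrite (Cderiv_unique _ _ _ _ (quotient_derive z hz) E), quotient_phi_B by exact hz.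
field. split; [exact h0 | apply phi_B_neq_0; exact hw].
Qed.

Lemma quotient_at_0 : G 0 = 1.
Proof. unfold G, Cdiv. ring. Qed.

Lemma quotient_d1_at_0 : G1 0 = a 2%nat.
Proof. unfold G1. rewrite factor_at_0, factor_d1_at_0. field. Qed.

Lemma schwarz_d1_at_0 : v 0 = a 2%nat.
Proof. unfold v. rewrite quotient_at_0, quotient_d1_at_0, w_0. field. Qed.

(** The formula for [v] contains w but not w', so mere differentiability of w already makes [v]
    differentiable. The value at 0 is w''(0), twice the second Taylor coefficient. *)
Lemma schwarz_d1_derive z : in_disk z -> exists l, Cderiv v z l /\
  (z = 0 -> l = 2 * (2 * a 3%nat - 3 / 2 * (a 2%nat * a 2%nat))).
Proof.
intros hz. destruct (quotient_d1_derive z hz) as [l [hl hl0]].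
assert (hG : G z <> 0) by (rewrite quotient_phi_B by exact hz; apply phi_B_neq_0, w_disk; exact hz).
eexists. split.
- unfold v. apply Cderiv_div.
  + apply Cderiv_mult; [exact hl|].
    apply Cderiv_plus; [apply Cderiv_const | apply schwarz_derive; exact hz].
  + apply Cderiv_mult; apply quotient_derive; exact hz.
  + apply Cmult_neq_0; exact hG.
- intros e. rewrite (hl0 e), e, quotient_at_0, quotient_d1_at_0, w_0. simpl. field.
Qed.

Lemma coefficient_bound : (Cmod (a 2%nat ^ 2 - a 3%nat) <= 1 / 2)%R.
Proof.
set (c1 := a 2%nat). set (c2 := 2 * a 3%nat - 3 / 2 * (c1 * c1)).
assert (B : (Cmod c1 ^ 2 + Cmod c2 ^ 2 <= 1)%R).
{ apply (bessel_coefficients w v).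
  - exact schwarz_derive.
  - intros z hz. destruct (schwarz_d1_derive z hz) as [l [hl _]].
    exact (Cderiv_continuous _ _ _ hl).
  - exact w_disk.
  - exact w_0.
  - exact schwarz_d1_at_0.
  - destruct (schwarz_d1_derive 0 in_disk_0) as [l [hl hl0]].
    eapply Cderiv_value; [exact hl | exact (hl0 eq_refl)]. }
replace (c1 ^ 2 - a 3%nat) with ((1 / 4)%R * (c1 * c1) + - ((1 / 2)%R * c2)).
2: { unfold c2. rewrite !RtoC_div by lra. field. }
eapply Rle_trans; [apply Cmod_triangle|].
rewrite Cmod_opp, !Cmod_mult, !Cmod_R, !Rabs_pos_eq by lra.
generalize (Cmod_ge_0 c1) (Cmod_ge_0 c2). set (x := Cmod c1) in *. set (y := Cmod c2) in *.
intros hx hy.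
(* With t = x^2, y <= sqrt (1 - t) <= 1 - t / 2. *)
assert (x * x <= 1)%R by nra.
destruct (Rle_dec y (1 - x * x / 2)) as [hle|hgt]; [nra|].
apply Rnot_le_lt in hgt. exfalso.
assert ((1 - x * x / 2) * (1 - x * x / 2) < y * y)%R by (apply Rmult_le_0_lt_compat; lra).
nra.
Qed.

End UpperBound.

(** * The extremal function *)

Fixpoint recursion_prefix (F : nat -> (nat -> R) -> R) (n : nat) : nat -> R :=
  match n with
  | O => fun _ => 0%R
  | S m => fun k => if Nat.eqb k m then F m (recursion_prefix F m) else recursion_prefix F m k
  end.

(** Each term may depend on all earlier ones, so finite tables are built by structural recursion; a
    table never changes an entry once it is set, and the diagonal is the sequence. *)
Lemma course_of_values (F : nat -> (nat -> R) -> R) :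
  (forall n e e', (forall k, (k < n)%nat -> e k = e' k) -> F n e = F n e') ->
  exists e, forall n, e n = F n e.
Proof.
intros hF. set (P := recursion_prefix F). exists (fun n => P (S n) n).
assert (stable : forall n k, (k < n)%nat -> P n k = P (S k) k).
{ intros n. induction n as [|n IH]; [lia|]. intros k hk.
  destruct (Nat.eq_dec k n) as [->|hne]; [reflexivity|].
  transitivity (P n k); [|apply IH; lia].
  unfold P; simpl. destruct (Nat.eqb_spec k n); [contradiction | reflexivity]. }
intros n. transitivity (F n (P n)).
- unfold P; simpl. rewrite Nat.eqb_refl. reflexivity.
- apply hF. intros k hk. apply stable. exact hk.
Qed.

(** Solves convolution equations for power series: constant [c] gives X = 1 + c u T X, and c n = s /
    (2 (n+1)) gives X' = (s / 2) T X. *)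
Lemma renewal_sequence (c t : nat -> R) : exists e : nat -> R, e 0%nat = 1%R /\
  forall n, e (S n) = (c n * sum_f_R0 (fun k => t k * e (n - k)%nat) n)%R.
Proof.
destruct (course_of_values (fun n e => match n with
  | O => 1%R | S m => (c m * sum_f_R0 (fun k => t k * e (m - k)%nat) m)%R end)) as [e he].
- intros [|m] e e' H; [reflexivity|]. f_equal. apply sum_eq. intros k hk. rewrite H by lia. reflexivity.
- exists e. split; [apply (he 0%nat) | intros n; apply (he (S n))].
Qed.

Lemma renewal_bound (c t e : nat -> R) : e 0%nat = 1%R ->
  (forall n, e (S n) = (c n * sum_f_R0 (fun k => t k * e (n - k)%nat) n)%R) ->
  (forall n, (Rabs (c n) * sum_f_R0 (fun k => Rabs (t k)) n <= 1)%R) ->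
  forall n, (Rabs (e n) <= 1)%R.
Proof.
intros e0 he hc n. induction n as [n IH] using lt_wf_ind. destruct n as [|n].
- rewrite e0, Rabs_R1. lra.
- rewrite he, Rabs_mult. eapply Rle_trans; [|apply (hc n)].
  apply Rmult_le_compat_l; [apply Rabs_pos|].
  eapply Rle_trans; [apply Rsum_abs|]. apply sum_Rle. intros k hk.
  rewrite Rabs_mult. rewrite <- (Rmult_1_r (Rabs (t k))) at 2.
  apply Rmult_le_compat_l; [apply Rabs_pos|]. apply IH. lia.
Qed.

(** * Products, shifts and the geometric series *)

Lemma disk_summable_RtoC (e : nat -> R) (M : R) : (forall n, (Rabs (e n) <= M)%R) ->
  disk_summable (fun n => RtoC (e n)).
Proof. intros h. apply (disk_summable_bounded _ M). intros n. rewrite Cmod_R. apply h. Qed.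

Lemma sum_n_RtoC (x : nat -> R) n :
  @sum_n C_NormedModule (fun k => RtoC (x k)) n = RtoC (sum_f_R0 x n).
Proof.
induction n as [|n IH]; [apply sum_O|]. rewrite sum_Sn, IH. simpl. rewrite RtoC_plus. reflexivity.
Qed.

Lemma sum_n_Cmult_r (x : nat -> C) (c : C) n :
  @sum_n C_NormedModule (fun k => x k * c) n = @sum_n C_NormedModule x n * c.
Proof. exact (sum_n_mult_r (K := C_Ring) c x n). Qed.

Lemma is_Cseries_conv (x y : nat -> R) (u : C) :
  disk_summable (fun n => RtoC (x n)) -> disk_summable (fun n => RtoC (y n)) -> in_disk u ->
  is_Cseries (fun n => RtoC (sum_f_R0 (fun k => x k * y (n - k)%nat)%R n) * u ^ n)
    (Cpsum (fun n => RtoC (x n)) u * Cpsum (fun n => RtoC (y n)) u).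
Proof.
intros hx hy hu.
eapply is_Cseries_ext; [|apply (is_Cseries_cauchy _ _ _ _
  (Cpsum_correct _ u hx hu) (Cpsum_correct _ u hy hu)); apply disk_summable_abs; assumption].
intros n. cbv beta. rewrite <- sum_n_RtoC, <- sum_n_Cmult_r.
apply sum_n_ext_loc. intros k hk. rewrite RtoC_mult.
replace (u ^ n) with (u ^ k * u ^ (n - k)) by (rewrite <- Cpow_add_r; f_equal; lia).
change (RtoC (x k) * u ^ k * (RtoC (y (n - k)%nat) * u ^ (n - k)) =
  RtoC (x k) * RtoC (y (n - k)%nat) * (u ^ k * u ^ (n - k))).
ring.
Qed.

Lemma Cpsum_ext x y u : (forall n, x n = y n) -> Cpsum x u = Cpsum y u.
Proof.
intros h. unfold Cpsum. f_equal; apply Series_ext; intros n; rewrite h; reflexivity.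
Qed.

Lemma Cpsum_minus x y u : disk_summable x -> disk_summable y -> in_disk u ->
  Cpsum (fun n => x n - y n) u = Cpsum x u - Cpsum y u.
Proof.
intros hx hy hu. apply Cpsum_unique.
eapply is_Cseries_ext; [|apply (is_Cseries_minus _ _ _ _ (Cpsum_correct x u hx hu) (Cpsum_correct y u hy hu))].
intros n. simpl. ring.
Qed.

Lemma Cpsum_incr x u : disk_summable x -> in_disk u ->
  Cpsum x u = x 0%nat + u * Cpsum (fun n => x (S n)) u.
Proof.
intros hx hu. apply Cpsum_unique, is_Cseries_decr.
eapply is_Cseries_value.
- eapply is_Cseries_ext; [|apply (is_Cseries_scal u _ _
    (Cpsum_correct _ u (disk_summable_incr x hx) hu))].
  intros n. rewrite Cpow_S. simpl. ring.
- simpl. ring.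
Qed.

Lemma one_minus_neq_0 u : in_disk u -> 1 - u <> 0.
Proof.
intros hu e. unfold in_disk in hu.
assert (u = 1) by (rewrite <- (Cplus_0_r u), <- e; ring).
subst u. rewrite Cmod_1 in hu. lra.
Qed.

Lemma Cpsum_geom u : in_disk u -> Cpsum (fun _ => 1) u = / (1 - u).
Proof.
intros hu. assert (h0 := one_minus_neq_0 u hu).
assert (hs : disk_summable (fun _ => 1)).
{ apply (disk_summable_bounded _ 1). intros n. rewrite Cmod_1. lra. }
assert (E := Cpsum_incr _ u hs hu). simpl in E.
set (s := Cpsum (fun _ => 1) u) in *.
transitivity ((s - u * s) / (1 - u)); [field; exact h0|].
rewrite E at 1. field. exact h0.
Qed.

(** * Power series of log (1 - u) and of phi_B (-u) *)

Lemma Clog_1 : Clog 1 = 0.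
Proof.
unfold Clog. rewrite Carg_atan by (simpl; lra). rewrite Cmod_1, ln_1. simpl.
unfold Rdiv. rewrite Rmult_0_l, atan_0. reflexivity.
Qed.

Lemma inv_INR_S_bounds n : (0 < / INR (S n) <= 1)%R.
Proof.
assert (h : (1 <= INR (S n))%R) by (rewrite S_INR; generalize (pos_INR n); lra).
split; [apply Rinv_0_lt_compat; lra|].
rewrite <- Rinv_1. apply Rinv_le_contravar; lra.
Qed.

Lemma disk_summable_inv_S : disk_summable (fun n => RtoC (/ INR (S n))).
Proof.
apply (disk_summable_RtoC _ 1). intros n. assert (h := inv_INR_S_bounds n). rewrite Rabs_pos_eq; lra.
Qed.

Lemma in_disk_opp u : in_disk u -> in_disk (- u).
Proof. unfold in_disk. rewrite Cmod_opp. trivial. Qed.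

Lemma Clog_series u : in_disk u ->
  Clog (1 + - u) = - (u * Cpsum (fun n => RtoC (/ INR (S n))) u).
Proof.
intros hu.
(* The series of - log (1 - u), indexed so that its formal derivative is the geometric series; the
   derivatives of both summands in [K] then cancel. *)
set (l := fun n => match n with O => RtoC 0 | S m => RtoC (/ INR (S m)) end).
assert (hl : disk_summable l).
{ apply (disk_summable_bounded _ 1). intros [|n]; unfold l.
  - rewrite Cmod_0. lra.
  - rewrite Cmod_R. assert (h := inv_INR_S_bounds n). rewrite Rabs_pos_eq; lra. }
assert (E := Cpsum_incr l u hl hu).
change (Cpsum l u = 0 + u * Cpsum (fun n => RtoC (/ INR (S n))) u) in E.
assert (K : Clog (1 + - u) + Cpsum l u = Clog (1 + - 0) + Cpsum l 0).
{ apply (Cderiv_zero_const (fun y => Clog (1 + - y) + Cpsum l y) u hu).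
  intros y hy. assert (h0 := one_minus_neq_0 y hy).
  eapply Cderiv_value.
  - apply Cderiv_plus; [|apply Cpsum_derive; assumption].
    apply (Cderiv_comp Clog (fun y => 1 + - y)).
    + apply Clog_derive, Re_one_plus_pos, in_disk_opp; exact hy.
    + apply Cderiv_plus; [apply Cderiv_const | apply Cderiv_opp, Cderiv_id].
  - rewrite (Cpsum_ext _ (fun _ => 1)), Cpsum_geom.
    + simpl. field. exact h0.
    + exact hy.
    + intros n. unfold Cps_derive. unfold l. rewrite <- RtoC_mult. f_equal.
      apply Rinv_r, not_0_INR. lia. }
replace (1 + - 0) with (RtoC 1) in K by ring.
rewrite Clog_1, Cpsum_0 in K. change (l 0%nat) with (RtoC 0) in K.
transitivity ((Clog (1 + - u) + Cpsum l u) - Cpsum l u); [ring|].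
rewrite K, E. ring.
Qed.

(* Coefficients of phi_B(-u) = 1/(1 - log (1-u)).  Multiplying the denominator by
   1 - u turns it into 1 - sum_{n >= 2} u^n / (n (n - 1)), whose subtracted
   coefficients are nonnegative with sum 1; hence its reciprocal has bounded
   coefficients. *)
Lemma phi_B_series : exists b : nat -> R, b 0%nat = (-1)%R /\
  (forall n, (Rabs (b n) <= 2)%R) /\
  forall u, in_disk u -> phi_B (- u) = 1 + u * Cpsum (fun n => RtoC (b n)) u.
Proof.
(* [t k] is the coefficient 1 / (n (n - 1)) for n = k + 1, shifted by one and split into a
   difference so that partial sums telescope. Then [r] lists the coefficients of 1 / (1 - u
   T(u)). *)
set (t := fun k => match k with O => 0%R | S j => (/ INR (S j) - / INR (S (S j)))%R end).
destruct (renewal_sequence (fun _ => 1%R) t) as [r [r0 hr]].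
assert (ht : forall n, (0 <= t n <= 1)%R).
{ intros [|n]; unfold t; [lra|].
  assert (h1 := inv_INR_S_bounds n). assert (h2 := inv_INR_S_bounds (S n)).
  assert (/ INR (S (S n)) <= / INR (S n))%R.
  { apply Rinv_le_contravar; [apply lt_0_INR; lia | apply le_INR; lia]. }
  lra. }
assert (htsum : forall n, sum_f_R0 (fun k => Rabs (t k)) n = (1 - / INR (S n))%R).
{ intros n. induction n as [|n IH].
  - simpl. rewrite Rabs_R0, Rinv_1. ring.
  - rewrite tech5, IH, Rabs_pos_eq by apply ht. unfold t. ring. }
assert (hr1 : forall n, (Rabs (r n) <= 1)%R).
{ apply (renewal_bound (fun _ => 1%R) t r r0 hr).
  intros n. rewrite htsum, Rabs_R1. assert (h := inv_INR_S_bounds n). lra. }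
(* phi_B (-u) = (1 - u) R(u) with r 0 = 1, whose coefficient of u^(n+1) is this difference. *)
exists (fun n => r (S n) - r n)%R. split; [|split].
- rewrite hr, r0. simpl. ring.
- intros n. eapply Rle_trans; [apply Rabs_triang|]. rewrite Rabs_Ropp.
  generalize (hr1 n) (hr1 (S n)). lra.
- intros u hu.
  assert (sr : disk_summable (fun n => RtoC (r n))) by exact (disk_summable_RtoC r 1 hr1).
  assert (st : disk_summable (fun n => RtoC (t n))).
  { apply (disk_summable_RtoC t 1). intros n. rewrite Rabs_pos_eq; apply ht. }
  assert (sm := disk_summable_inv_S).
  set (Rs := Cpsum (fun n => RtoC (r n)) u).
  set (Ts := Cpsum (fun n => RtoC (t n)) u).
  set (Ms := Cpsum (fun n => RtoC (/ INR (S n))) u).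
  set (Rs1 := Cpsum (fun n => RtoC (r (S n))) u).
  assert (E1 : Rs = 1 + u * Rs1).
  { unfold Rs. rewrite (Cpsum_incr _ u sr hu), r0. reflexivity. }
  assert (E2 : Rs1 = Ts * Rs).
  { apply Cpsum_unique.
    eapply is_Cseries_ext; [|exact (is_Cseries_conv t r u st sr hu)].
    intros n. rewrite hr, Rmult_1_l. reflexivity. }
  assert (E3 : (1 - u) * Ms = 1 - Ts).
  { assert (F1 := Cpsum_incr _ u sm hu). assert (F2 := Cpsum_incr _ u st hu).
    fold Ms in F1. fold Ts in F2.
    assert (F3 : Cpsum (fun n => RtoC (t (S n))) u = Ms - Cpsum (fun n => RtoC (/ INR (S (S n)))) u).
    { unfold Ms. rewrite <- Cpsum_minus; [|exact sm | exact (disk_summable_incr _ sm) | exact hu].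
      apply Cpsum_ext. intros n. unfold t. rewrite RtoC_minus. reflexivity. }
    rewrite F2, F3. unfold t.
    transitivity (Ms - u * Ms); [ring|]. rewrite F1 at 1.
    replace (/ INR 1)%R with 1%R by (simpl; field). ring. }
  rewrite (Cpsum_ext _ (fun n => RtoC (r (S n)) - RtoC (r n))) by (intros n; apply RtoC_minus).
  rewrite Cpsum_minus; [|exact (disk_summable_incr _ sr) | exact sr | exact hu].
  fold Rs Rs1.
  assert (h0 := one_minus_Clog_neq_0 (- u) (in_disk_opp u hu)).
  unfold phi_B. rewrite Clog_series in h0 |- * by exact hu. fold Ms in h0 |- *.
  assert (E4 : (1 + u * (Rs1 - Rs)) * (1 - - (u * Ms)) = 1).
  { replace (1 + u * (Rs1 - Rs)) with (Rs - u * Rs) by (rewrite E1; ring).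
    transitivity (Rs * (1 - u + u * ((1 - u) * Ms))); [ring|].
    rewrite E3. transitivity (Rs - u * (Ts * Rs)); [ring|].
    rewrite <- E2, E1. ring. }
  transitivity ((1 + u * (Rs1 - Rs)) * (1 - - (u * Ms)) / (1 - - (u * Ms)));
    [rewrite E4; reflexivity | field; exact h0].
Qed.

(** A subsequence of the partial sums has the same limit. Pairing lets the odd series of the
    extremal function be compared with a series in z^2. *)
Lemma is_Cseries_pairs x l : is_Cseries x l ->
  is_Cseries (fun k => x (2 * k)%nat + x (2 * k + 1)%nat) l.
Proof.
intros h.
apply (filterlim_ext (fun n => @sum_n C_NormedModule x (2 * n + 1))).
- intros n. induction n as [|n IH].
  + simpl. rewrite sum_Sn, !sum_O. reflexivity.
  + replace (2 * S n + 1)%nat with (S (S (2 * n + 1))) by lia.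
    rewrite !sum_Sn, IH.
    replace (2 * S n)%nat with (S (2 * n + 1)) by lia.
    replace (S (2 * n + 1) + 1)%nat with (S (S (2 * n + 1))) by lia.
    symmetry. apply Cplus_assoc.
- apply (filterlim_comp _ _ _ (fun n => 2 * n + 1)%nat (@sum_n C_NormedModule x) eventually eventually); [|exact h].
  intros Q [N hN]. exists N. intros n hn. apply hN. lia.
Qed.

Lemma extremal_function : exists (f : C -> C) (a : nat -> C),
  class_S_B f /\ has_expansion f a /\ Cmod (a 2%nat ^ 2 - a 3%nat) = (1 / 2)%R.
Proof.
destruct phi_B_series as [b [b0 [hb hphi]]].
(* The n + 1 summands are at most 2, which the factor 1 / (2 (n+1)) of the recurrence cancels
   exactly. *)
assert (hsum : forall n, (sum_f_R0 (fun k => Rabs (b k)) n <= 2 * INR (S n))%R).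
{ intros n. eapply Rle_trans; [apply (sum_Rle _ (fun _ => 2%R)); intros k _; apply hb|].
  rewrite sum_cte. lra. }
assert (hc : forall n, (/ (2 * INR (S n)) * sum_f_R0 (fun k => Rabs (b k)) n <= 1)%R).
{ intros n. assert (h : (0 < INR (S n))%R) by (apply lt_0_INR; lia).
  apply (Rmult_le_reg_l (2 * INR (S n))); [lra|].
  rewrite <- Rmult_assoc, Rinv_r, Rmult_1_l, Rmult_1_r by lra. apply hsum. }
assert (hcabs : forall n, Rabs (/ (2 * INR (S n))) = (/ (2 * INR (S n)))%R).
{ intros n. apply Rabs_pos_eq. left. apply Rinv_0_lt_compat.
  assert (h : (0 < INR (S n))%R) by (apply lt_0_INR; lia). lra. }
destruct (renewal_sequence (fun n => / (2 * INR (S n)))%R b) as [e [e0 he]].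
(* The opposite sign produces the reciprocal: [E'] below is 1 / E, not a derivative. *)
destruct (renewal_sequence (fun n => - / (2 * INR (S n)))%R b) as [e' [e'0 he']].
assert (be : forall n, (Rabs (e n) <= 1)%R).
{ apply (renewal_bound _ b e e0 he). intros n. rewrite hcabs. apply hc. }
assert (be' : forall n, (Rabs (e' n) <= 1)%R).
{ apply (renewal_bound _ b e' e'0 he'). intros n. rewrite Rabs_Ropp, hcabs. apply hc. }
assert (sb := disk_summable_RtoC b 2 hb).
assert (se := disk_summable_RtoC e 1 be).
assert (se' := disk_summable_RtoC e' 1 be').
set (psi := Cpsum (fun n => RtoC (b n))) in *.
set (E := Cpsum (fun n => RtoC (e n))).
set (E' := Cpsum (fun n => RtoC (e' n))).
assert (ode : forall (s : R) (x : nat -> R),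
  (forall n, x (S n) = (s * / (2 * INR (S n)) * sum_f_R0 (fun k => b k * x (n - k)%nat) n)%R) ->
  disk_summable (fun n => RtoC (x n)) ->
  forall u, in_disk u -> Cderiv (Cpsum (fun n => RtoC (x n))) u
    ((s / 2)%R * (psi u * Cpsum (fun n => RtoC (x n)) u))).
{ intros s x hx sx u hu. eapply Cderiv_value; [apply Cpsum_derive; assumption|].
  apply Cpsum_unique.
  eapply is_Cseries_ext; [|exact (is_Cseries_scal _ _ _ (is_Cseries_conv b x u sb sx hu))].
  intros n. unfold Cps_derive. rewrite hx, Cmult_assoc, <- !RtoC_mult. do 2 f_equal.
  field. apply not_0_INR. lia. }
assert (dE : forall u, in_disk u -> Cderiv E u ((1 / 2)%R * (psi u * E u))).
{ apply ode; [intros n; rewrite he; ring | exact se]. }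
assert (dE' : forall u, in_disk u -> Cderiv E' u ((-1 / 2)%R * (psi u * E' u))).
{ apply ode; [intros n; rewrite he'; ring | exact se']. }
assert (hEE : forall u, in_disk u -> E u * E' u = 1).
{ intros u hu. rewrite (Cderiv_zero_const (fun y => E y * E' y) u hu).
  - unfold E, E'. rewrite !Cpsum_0, e0, e'0. ring.
  - intros y hy. eapply Cderiv_value; [apply Cderiv_mult; [apply dE | apply dE']; exact hy|].
    simpl. replace (-1 / 2)%R with (- (1 / 2))%R by field. rewrite RtoC_opp. ring. }
assert (hE : forall u, in_disk u -> E u <> 0).
{ intros u hu h. apply C1_nz. rewrite <- (hEE u hu), h. ring. }
assert (hsq : forall z, in_disk z -> in_disk (z * z)).
{ intros z. unfold in_disk. rewrite Cmod_mult. generalize (Cmod_ge_0 z). nra. }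
set (f := fun z => z * E (z * z)).
assert (dEsq : forall z, in_disk z ->
  Cderiv (fun y => E (y * y)) z (z * (psi (z * z) * E (z * z)))).
{ intros z hz. eapply Cderiv_value.
  - apply (Cderiv_comp E (fun y => y * y)); [apply dE, hsq; exact hz|].
    apply Cderiv_mult; apply Cderiv_id.
  - simpl. rewrite RtoC_div by lra. field. }
assert (df : forall z, in_disk z ->
  Cderiv f z (E (z * z) + z * (z * (psi (z * z) * E (z * z))))).
{ intros z hz. eapply Cderiv_value; [apply Cderiv_mult; [apply Cderiv_id | apply dEsq; exact hz]|].
  simpl. ring. }
assert (hq : forall z, in_disk z -> log_deriv_quotient f z = phi_B (- (z * z))).
{ intros z hz. rewrite hphi by (apply hsq; exact hz).
  rewrite (log_deriv_quotient_factored f (fun y => E (y * y)) z _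
    (fun y _ => eq_refl) hz (hE _ (hsq z hz)) (dEsq z hz)).
  field. apply hE, hsq; exact hz. }
assert (E0 : E (0 * 0) = 1).
{ replace (0 * 0) with (RtoC 0) by ring. unfold E. rewrite Cpsum_0, e0. reflexivity. }
set (a := fun n => if Nat.odd n then RtoC (e (Nat.div2 n)) else 0).
exists f, a. split; [split; [split; [|split]|split] | split].
- intros z hz. eexists. apply df; exact hz.
- unfold f. ring.
- rewrite (is_C_derive_unique _ _ _ (df 0 in_disk_0)), E0. ring.
- intros z hz hz0. apply Cmult_neq_0; [exact hz0 | apply hE, hsq; exact hz].
- split; [|split].
  + intros z hz. eexists.
    apply (Cderiv_disk_ext (fun y => phi_B (- (y * y)))); [exact hz | intros y hy; symmetry; apply hq; exact hy|].
    apply (Cderiv_comp phi_B (fun y => - (y * y))).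
    * apply phi_B_derive, in_disk_opp, hsq; exact hz.
    * apply Cderiv_opp, Cderiv_mult; apply Cderiv_id.
  + intros z hz. eexists. apply phi_B_derive; exact hz.
  + exists (fun z => - (z * z)). split; [|split; [|split]].
    * intros z hz. eexists. apply Cderiv_opp, Cderiv_mult; apply Cderiv_id.
    * intros z hz. apply in_disk_opp, hsq; exact hz.
    * ring.
    * exact hq.
- split; [reflexivity | split; [unfold a; simpl; rewrite e0; reflexivity|]].
  intros z hz. apply is_pseries_Cseries.
  assert (sa : disk_summable a).
  { apply (disk_summable_bounded _ 1). intros n. unfold a. destruct (Nat.odd n).
    - rewrite Cmod_R. apply be.
    - rewrite Cmod_0. lra. }
  assert (S1 := Cpsum_correct a z sa hz).
  eapply is_Cseries_value; [exact S1|].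
  apply (is_Cseries_unique _ _ _ (is_Cseries_pairs _ _ S1)).
  eapply is_Cseries_ext; [|apply (is_Cseries_scal z _ _ (Cpsum_correct _ _ se (hsq z hz)))].
  intros n. cbv beta. unfold a.
  assert (o1 : Nat.odd (2 * n) = false) by (rewrite Nat.odd_mul; reflexivity).
  assert (o2 : Nat.odd (2 * n + 1) = true) by (rewrite Nat.odd_add, o1; reflexivity).
  rewrite o1, o2, Nat.add_1_r.
  rewrite Nat.div2_succ_double, Cpow_S, Cpow_mult_r.
  replace (z ^ 2) with (z * z) by (simpl; ring). ring.
(* Here a2 = 0 and a3 = e 1 = b 0 / 2 = - 1 / 2. *)
- assert (e1 : e 1%nat = (- (1 / 2))%R) by (rewrite he; simpl; rewrite b0, e0; field).
  change (Cmod (0 ^ 2 - RtoC (e 1%nat)) = (1 / 2)%R). rewrite e1, RtoC_opp.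
  replace (0 ^ 2 - - RtoC (1 / 2)) with (RtoC (1 / 2)) by ring.
  rewrite Cmod_R, Rabs_pos_eq; lra.
Qed.

Theorem theorem2p8 :
  (forall (f : C -> C) (a : nat -> C),
      class_S_B f -> has_expansion f a ->
      (Cmod (a 2%nat ^ 2 - a 3%nat) <= 1 / 2)%R) /\
  (exists (f : C -> C) (a : nat -> C),
      class_S_B f /\ has_expansion f a /\
      Cmod (a 2%nat ^ 2 - a 3%nat) = (1 / 2)%R).
Proof.
split; [|exact extremal_function].
intros f a [_ [f_neq_0 [_ [_ [w [w_analytic [w_disk [w_0 f_w]]]]]]]] hE.
exact (coefficient_bound f a w hE f_neq_0 w_analytic w_disk w_0 f_w).
Qed.
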